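(* Let $\sigma\ge 0$ and $p>1$, and let $u^\dagger$ be the exact solution of the Cauchy problem $$-\triangle_x u-\partial_y^2u=0 \text{ in }\Omega\times(0,\bar\ell),\qquad u(\cdot,y)=0\text{ on }\partial\Omega \ (y\in(0,\bar\ell)),\qquad u(x,0)=f(x),\ \partial_yu(x,0)=g(x)\ (x\in\Omega),$$ with unstable component $u_+^\dagger$ satisfying $u_+^\dagger\in L^2(0,\bar\ell;H^{\sigma+1+1/p}(\Omega))$. For noise levels $\delta>0$ let noisy data $u_{+0}^\delta\in L^2(\Omega)$ satisfy $\|u_{+0}^\delta-u_{+0}\|_{L^2(\Omega)}\le\delta$, and let $u_{+0}^{\tilde\delta}$ be the smoothed data obtained from $u_{+0}^\delta$ by $i_*(\delta)$ Landweber steps as described in the context, with $\tilde\delta=\tilde\delta(\delta)$ the associated noise level of the smoothed data. Assume that $\alpha=\alpha(\tilde\delta)\in(0,1)$ is chosen such that $$\alpha(\tilde\delta)\to1\quad\text{and}\quad \Gamma(1-\alpha(\tilde\delta))\,\tilde\delta\to0\qquad\text{as }\delta\to0 .$$ Then the reconstructions $u^{\alpha(\tilde\delta),\delta}$ satisfy $$\|u^\dagger-u^{\alpha(\tilde\delta),\delta}\|_{L^2(0,\bar\ell;H^\sigma(\Omega))}\to0\qquad\text{as }\delta\to0 .$$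
   Context: $\Omega\subset\mathbb{R}^d$ is a bounded Lipschitz domain, $\bar\ell\in(0,\infty)$. $(\lambda_j,\phi_j)_{j\in\mathbb{N}}$ are the eigenvalues and $L^2(\Omega)$-orthonormal eigenfunctions of $-\triangle_x$ on $\Omega$ with homogeneous Dirichlet boundary conditions. For a function $v$ on $\Omega$, $v_j$ denotes its coefficient with respect to $\phi_j$; the norm of $H^s(\Omega)$ is $\|v\|_{H^s(\Omega)}=(\sum_j\lambda_j^s|v_j|^2)^{1/2}$, and powers of $-\triangle_x$ are defined spectrally. Splitting of the solution: $u_{\pm0}:=\tfrac12\bigl(f\pm(-\triangle_x)^{-1/2}g\bigr)$, and $u^\dagger=u_+^\dagger+u_-^\dagger$ with $$u_+^\dagger(x,y)=\sum_j u_{+0,j}\,e^{\sqrt{\lambda_j}\,y}\phi_j(x),\qquad u_-^\dagger(x,y)=\sum_j u_{-0,j}\,e^{-\sqrt{\lambda_j}\,y}\phi_j(x).$$ The component $u_+^\dagger$ is the unstable one; it is assumed nonzero. Mittag-Leffler function: $E_{\alpha,\beta}(z)=\sum_{k=0}^\infty z^k/\Gamma(\alpha k+\beta)$. Smoothed data: let $A=\mu(-\triangle_x)^{-\tilde\sigma}$ with $\tilde\sigma=\sigma+1$ and $\mu>0$ such that $\|A\|_{L^2(\Omega)\to L^2(\Omega)}\le1$. Set $v^{(0)}=0$, $v^{(i+1)}=v^{(i)}-A(v^{(i)}-u_{+0}^\delta)$, and $u_{+0}^{\tilde\delta}:=v^{(i_* )}$, where, for some fixed $l\in(0,\bar\ell)$,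 the number of steps $i_*=i_*(\delta)\in\mathbb{N}$ is chosen (for $\delta$ sufficiently small) such that $$i_*\sim l^{-2}\log\Bigl(\frac{\|u_+^\dagger(\cdot,l)\|_{L^2(\Omega)}}{\delta}\Bigr),$$ i.e. the ratio of both sides stays between two positive constants independent of $\delta$. Put $$\tilde\delta:=C_2\,l^{-1}\,\delta\,\sqrt{\log\Bigl(\frac{\|u_+^\dagger(\cdot,l)\|_{L^2(\Omega)}}{\delta}\Bigr)}$$ with a constant $C_2>0$ independent of $l$ and $\delta$. Reconstruction: the unstable component is regularised by replacing the first order $y$-derivative with a fractional derivative of order $\alpha$, giving $$u^{\alpha,\delta}(x,y)=\sum_j\Bigl(\frac{(u_{+0}^{\tilde\delta})_j}{E_{\alpha,1}(-\sqrt{\lambda_j}\,y^\alpha)}+u_{-0,j}\,e^{-\sqrt{\lambda_j}\,y}\Bigr)\phi_j(x).$$ *)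

(* Defs.v *)
From HB Require Import structures.
From mathcomp Require Import all_boot all_order all_algebra.
From mathcomp Require Import all_classical all_reals all_analysis.

Set Implicit Arguments.
Unset Strict Implicit.
Unset Printing Implicit Defensive.

Import Order.TTheory GRing.Theory Num.Theory.
Import numFieldNormedType.Exports.

Local Open Scope classical_set_scope.
Local Open Scope ring_scope.

Section lebesgue_tuple.
Context (R : realType).
Let X := measurableTypeR R.

Definition tcons n (p : X * n.-tuple X) : n.+1.-tuple X := [tuple of p.1 :: p.2].

Lemma measurable_tcons n : measurable_fun setT (@tcons n).
Proof. exact: measurable_cons. Qed.

Section step.
Context (n : nat) (m : {sigma_finite_measure set (n.-tuple X) -> \bar R}).

Definition lebesgue_tcons : set (n.+1.-tuple X) -> \bar R :=
  pushforward (lebesgue_measure \x m)%E (@tcons n).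

Let lebesgue_tcons0 : lebesgue_tcons set0 = 0%E.
Proof. by rewrite /lebesgue_tcons /pushforward preimage_set0 measure0. Qed.

Let mtc (A : set (n.+1.-tuple X)) : measurable A -> measurable (@tcons n @^-1` A).
Proof. by move=> mA; rewrite -[X in measurable X]setTI; exact: measurable_tcons. Qed.

Let lebesgue_tcons_ge0 A : (0 <= lebesgue_tcons A)%E.
Proof. by rewrite /lebesgue_tcons /pushforward; exact: measure_ge0. Qed.

Let lebesgue_tcons_sigma_additive : semi_sigma_additive lebesgue_tcons.
Proof.
move=> F mF tF mUF; rewrite /lebesgue_tcons /pushforward preimage_bigcup.
apply: measure_semi_sigma_additive.
- by move=> i; exact: mtc.
- apply/trivIsetP => /= i j _ _ ij; rewrite -preimage_setI.
  by move/trivIsetP : tF => /(_ _ _ _ _ ij) ->//; rewrite preimage_set0.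
- by rewrite -preimage_bigcup; exact: mtc.
Qed.

HB.instance Definition _ := isMeasure.Build _ _ _ lebesgue_tcons
  lebesgue_tcons0 lebesgue_tcons_ge0 lebesgue_tcons_sigma_additive.

Let lebesgue_tcons_sigma_finite : sigma_finite setT lebesgue_tcons.
Proof.
have /sigma_finiteP[F [TF ndF Foo]] := sigma_finiteT (@lebesgue_measure R).
have /sigma_finiteP[G [TG ndG Goo]] := sigma_finiteT m.
pose g (t : n.+1.-tuple X) : X * n.-tuple X := (thead t, [tuple of behead t]).
have mg : measurable_fun setT g.
  apply: measurable_fun_pair; first exact: measurable_tnth.
  exact: measurable_behead.
have gK : cancel (@tcons n) g.
  by move=> [x t]; rewrite /g /tcons theadE; congr pair; apply: val_inj.
exists (fun i => g @^-1` (F i `*` G i)).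
  rewrite -preimage_bigcup (_ : \bigcup_i _ = setT) ?preimage_setT//.
  apply/seteqP; split => // -[x y] _.
  have [i _ Fx] : (\bigcup_i F i) x by rewrite -TF.
  have [j _ Gy] : (\bigcup_i G i) y by rewrite -TG.
  exists (maxn i j) => //; split.
  - by move: x Fx; exact/subsetPset/ndF/leq_maxl.
  - by move: y Gy; exact/subsetPset/ndG/leq_maxr.
move=> i; have [mFi Fioo] := Foo i; have [mGi Gioo] := Goo i; split.
  by rewrite -[X in measurable X]setTI; apply: mg => //; exact: measurableX.
rewrite /= /lebesgue_tcons /pushforward -comp_preimage.
rewrite (_ : g \o _ = id); last by apply/funext => x /=; rewrite gK.
by rewrite preimage_id product_measure1E// lte_mul_pinfty// ge0_fin_numE.
Qed.

HB.instance Definition _ := Measure_isSigmaFinite.Build _ _ _ lebesgue_tcons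
  lebesgue_tcons_sigma_finite.

End step.

Fixpoint lebesgue_tuple n : {sigma_finite_measure set (n.-tuple X) -> \bar R} :=
  if n is n'.+1 then lebesgue_tcons (lebesgue_tuple n')
  else dirac ([tuple] : 0.-tuple X).

Lemma lebesgue_tuple_box n (a b : 'I_n -> R) :
  lebesgue_tuple n [set t | forall i, a i <= (tnth t i : R) <= b i] =
  (\prod_(i < n) (lebesgue_measure `[a i, b i]))%E.
Proof.
elim: n a b => [|n IH] a b /=.
  by rewrite big_ord0 diracE mem_set//=; case.
rewrite /lebesgue_tcons /pushforward.
rewrite (_ : _ @^-1` _ = `[a ord0, b ord0]%classic `*`
    [set t : n.-tuple X | forall i,
       a (lift ord0 i) <= (tnth t i : R) <= b (lift ord0 i)]); last first.
  apply/seteqP; split => [[x t] /= H|[x t] /= [H1 H2] i].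
    split; first by have := H ord0; rewrite in_itv.
    by move=> i; have := H (lift ord0 i); rewrite tnthS.
  case: (unliftP ord0 i) => [j ->|->]; first by rewrite tnthS; apply: H2.
  by move: H1; rewrite in_itv.
rewrite big_ord_recl -IH product_measure1E//.
rewrite (_ : [set _ | _] = \bigcap_(i in [set` enum 'I_n])
    ((fun t : n.-tuple X => tnth t i) @^-1` `[a (lift ord0 i), b (lift ord0 i)])).
  rewrite bigcap_seq; apply: bigsetI_measurable => i _.
  by rewrite -[X in measurable X]setTI; exact: measurable_tnth.
apply/seteqP; split => t /= H i.
  by move=> _ /=; rewrite in_itv; apply: H.
by have := H i; rewrite /= in_itv mem_enum; apply.
Qed.

End lebesgue_tuple.

Section lebesgue_rV.
Context (R : realType) (d : nat).
Let X := measurableTypeR R.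

Local Notation borel_rV := (g_sigma_algebraType (@open 'rV[R]_d)).

Definition rV_of_tuple (t : d.-tuple X) : borel_rV := \row_i (tnth t i : R).

Lemma measurable_rV_of_tuple : measurable_fun setT rV_of_tuple.
Proof.
apply: (@measurability _ _ _ borel_rV setT rV_of_tuple (@open 'rV[R]_d)) => //.
move=> _ [U oU <-]; rewrite setTI.
pose I := ('rV[rat]_d * rat)%type.
pose B (c : I) (i : 'I_d) : set (d.-tuple X) :=
  (fun t : d.-tuple X => tnth t i) @^-1`
    (ball (ratr (c.1 0 i) : R) (ratr c.2) : set X).
pose P (c : I) : set (d.-tuple X) :=
  [set t | 0 < c.2 /\ (ball (map_mx ratr c.1 : 'rV[R]_d) (ratr c.2) `<=` U) /\
           forall i, B c i t].
have mB c i : measurable (B c i).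
  rewrite -[X in measurable X]setTI; apply: measurable_tnth => //.
  exact: measurable_realfun.measurable_ball.
have mP c : measurable (P c).
  have [c0|c0] := pselect (0 < c.2 /\
      ball (map_mx ratr c.1 : 'rV[R]_d) (ratr c.2) `<=` U); last first.
    rewrite (_ : P c = set0) //; apply/seteqP; split => // t [? [? _]].
    by apply: c0.
  rewrite (_ : P c = \bigcap_(i in [set` enum 'I_d]) B c i).
    by rewrite bigcap_seq; exact: bigsetI_measurable.
  apply/seteqP; split => t /=; first by move=> [_ [_ Bt]] i _; exact: Bt.
  by move=> Bt; do 2 (split; first exact: (proj1 c0) || exact: (proj2 c0));
     move=> i; apply: Bt => /=; rewrite mem_enum.
rewrite (_ : _ @^-1` U = \bigcup_c P c).
  by apply: countable_bigcupT_measurable => //; exact: countableP.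
apply/seteqP; split => [t /= Ut|t /= [c _ [c0 [cU Bt]]]]; last first.
  apply: cU; split; first by rewrite ltr0q.
  by move=> i j; rewrite !mxE ord1; exact: Bt.
have : nbhs (rV_of_tuple t : 'rV[R]_d) U by exact: open_nbhs_nbhs.
move=> /nbhs_ballP[e /= e0 eU].
have [r] := rat_in_itvoo (divr_gt0 e0 (ltr0n _ 2)).
rewrite in_itv/= => /andP[r0 re].
have /choice[q qP] i : exists q : rat, ball (tnth t i : R) (ratr r) (ratr q).
  have [|q] := @rat_in_itvoo _ ((tnth t i : R) - ratr r) (tnth t i + ratr r).
    by rewrite ltrBlDr -addrA ltrDl addr_gt0.
  by rewrite ball_itv/=; exists q.
exists (\row_i q i, r) => //; split; first by rewrite ltr0q in r0.
split => [y [_ qy]|i]; last first.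
  by rewrite /B/= mxE; apply: ball_sym; exact: qP.
apply: eU; split => // i j; rewrite mxE ord1.
rewrite (splitr e); apply: (@ball_triangle _ R^o (ratr (q j) : R^o)).
  by apply: (le_ball (ltW re)); exact: qP.
by apply: (le_ball (ltW re)); have := qy 0 j; rewrite !mxE.
Qed.

Definition lebesgue_rV : set borel_rV -> \bar R :=
  pushforward (lebesgue_tuple R d) rV_of_tuple.

HB.instance Definition _ := Measure.copy lebesgue_rV
  (measure_function_pushforward__canonical__measure_function_Measure
    (lebesgue_tuple R d) measurable_rV_of_tuple).

End lebesgue_rV.

Section domain.
Context (R : realType) (d : nat).
Implicit Type x : 'rV[R]_d.

Definition dot (x e : 'rV[R]_d) : R := \sum_(i < d) x 0 i * e 0 i.

(* Near each boundary point, Om is the strict subgraph of a Lipschitz function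
   over the hyperplane orthogonal to a unit vector e; gam is evaluated at the
   orthogonal projection of z on that hyperplane. *)
Definition lipschitz_boundary (Om : set 'rV[R]_d) :=
  forall x, (closure Om `\` Om) x ->
  exists (e : 'rV[R]_d) (gam : 'rV[R]_d -> R) (L r : R),
    [/\ dot e e = 1, 0 < r,
        forall y z, `|gam y - gam z| <= L * `|y - z| &
        forall z, ball x r z -> Om z <-> dot z e < gam (z - dot z e *: e)].

Record lipschitz_domain := LipschitzDomain {
  dom :> set 'rV[R]_d;
  dom_open : open dom;
  dom_nonempty : dom !=set0;
  dom_connected : connected dom;
  dom_bounded : bounded_set dom;
  dom_lipschitz : lipschitz_boundary dom }.

Lemma measurable_dom (Om : lipschitz_domain) :
  @measurable _ (g_sigma_algebraType (@open 'rV[R]_d)) Om.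
Proof. by apply: sub_sigma_algebra; exact: dom_open. Qed.

(* Functions on Om are represented by Borel functions on 'rV[R]_d, of which only
   the values in Om matter: integrals over Om are integrals with respect to
   Lebesgue measure restricted to Om. *)
Definition dom_measure (Om : lipschitz_domain) :=
  mrestr (@lebesgue_rV R d) (measurable_dom Om).
HB.instance Definition _ Om := Measure.on (dom_measure Om).

Definition L2 (Om : lipschitz_domain) := Lfun (dom_measure Om) 2%:E.

Definition L2norm (Om : lipschitz_domain) (v : 'rV[R]_d -> R) : \bar R :=
  'N[dom_measure Om]_2[EFin \o v]%E.

Definition L2ip (Om : lipschitz_domain) (v w : 'rV[R]_d -> R) : R :=
  (\int[dom_measure Om]_x (v x * w x))%R.

Definition partial (i : 'I_d) (f : 'rV[R]_d -> R) : 'rV[R]_d -> R :=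
  fun x => 'D_(delta_mx 0 i) f x.

Definition smooth (f : 'rV[R]_d -> R) := forall s : seq 'I_d,
  continuous (foldr partial f s) /\
  forall i x, derivable (foldr partial f s) x (delta_mx 0 i).

Definition test_function (Om : set 'rV[R]_d) (f : 'rV[R]_d -> R) :=
  [/\ smooth f, compact (closure [set x | f x != 0]) &
      closure [set x | f x != 0] `<=` Om].

(* H^1_0(Om) is the closure of the test functions for the H^1 norm; G is the
   (weak) gradient of v. *)
Definition H10_grad (Om : lipschitz_domain) (v : 'rV[R]_d -> R)
    (G : 'I_d -> 'rV[R]_d -> R) :=
  [/\ v \in L2 Om, forall i, G i \in L2 Om &
      exists psi : nat -> 'rV[R]_d -> R,
        [/\ forall n, test_function Om (psi n),
            L2norm Om (psi n \- v) @[n --> \oo] --> 0%E &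
            forall i, L2norm Om (partial i (psi n) \- G i) @[n --> \oo] --> 0%E]].

Definition dirichlet_eigenpair (Om : lipschitz_domain) (mu : R) (v : 'rV[R]_d -> R) :=
  exists G, H10_grad Om v G /\
    forall psi H, H10_grad Om psi H ->
      \sum_(i < d) L2ip Om (G i) (H i) = mu * L2ip Om v psi.

Section spectral.
Context (Om : lipschitz_domain) (lam : nat -> R) (phi : nat -> 'rV[R]_d -> R).

Definition coef (v : 'rV[R]_d -> R) (j : nat) : R := L2ip Om v (phi j).

(* v = \sum_j c j phi_j in L^2(Om) *)
Definition L2sum (c : nat -> R) (v : 'rV[R]_d -> R) :=
  v \in L2 Om /\
  L2norm Om (fun x => v x - \sum_(0 <= j < n) c j * phi j x) @[n --> \oo] --> 0%E.

(* The lam j are automatically positive (Poincare inequality); this is recorded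
   because it is what gives a meaning to the powers of - Delta. *)
Record dirichlet_eigensystem : Prop := DirichletEigensystem {
  eigensystem_pair : forall j, dirichlet_eigenpair Om (lam j) (phi j);
  eigensystem_gt0 : forall j, 0 < lam j;
  eigensystem_orthonormal : forall i j, L2ip Om (phi i) (phi j) = (i == j)%:R;
  eigensystem_complete : forall v : 'rV[R]_d -> R, v \in L2 Om -> L2sum (coef v) v }.

(* w = (- Delta)^s v *)
Definition laplace_pow (s : R) (v w : 'rV[R]_d -> R) :=
  L2sum (fun j => lam j `^ s * coef v j) w.

Definition Hs_norm (s : R) (v : 'rV[R]_d -> R) : \bar R :=
  ((\sum_(0 <= j <oo) (lam j `^ s * coef v j ^+ 2)%:E) `^ 2^-1)%E.

(* norm of L^2(0, ell; H^s(Om)) *)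
Definition L2Hs_norm (ell s : R) (w : R -> 'rV[R]_d -> R) : \bar R :=
  ((\int[lebesgue_measure]_(y in `]0%R, ell[) (Hs_norm s (w y) `^ 2)) `^ 2^-1)%E.

End spectral.

(* Weak formulation of the Cauchy problem
     - Delta_x u - d^2 u/dy^2 = 0 in Om x (0, ell), u = 0 on the lateral boundary,
     u = f and du/dy = g at y = 0. *)
Definition cauchy_solution (Om : lipschitz_domain) (ell : R) (f g : 'rV[R]_d -> R)
    (u : R -> 'rV[R]_d -> R) :=
  exists G : R -> 'I_d -> 'rV[R]_d -> R,
    (forall y : R, 0 < y < ell -> H10_grad Om (u y) (G y)) /\
    forall psi H, H10_grad Om psi H ->
      let w := fun y => L2ip Om (u y) psi in
      [/\ forall y : R, 0 < y < ell ->
            [/\ derivable w y 1, derivable (derive1 w) y 1 &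
                derive1 (derive1 w) y = \sum_(i < d) L2ip Om (G y i) (H i)],
          w y @[y --> 0^'+] --> L2ip Om f psi &
          derive1 w y @[y --> 0^'+] --> L2ip Om g psi].

End domain.

Section reconstruction.
Context (R : realType).

(* Euler's integral, meaningful for x > 0. *)
Definition Gamma (x : R) : R :=
  \int[lebesgue_measure]_(t in `]0%R, +oo[) (t `^ (x - 1) * expR (- t)).

Definition mittag_leffler (a b z : R) : R :=
  limn (series (fun k => z ^+ k / Gamma (a * k%:R + b))).

Fixpoint landweber (T : Type) (A : (T -> R) -> T -> R) (w : T -> R) (i : nat) : T -> R :=
  if i is i'.+1 then
    let v := landweber A w i' in v \- A (v \- w)
  else cst 0.

End reconstruction.

(* Main.v *)
Require Import Defs.
From mathcomp Require Import all_boot all_order all_algebra.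
From mathcomp Require Import all_classical all_reals all_analysis.
From mathcomp Require Import measurable_realfun.
From mathcomp Require Import ring lra.
Import Order.TTheory GRing.Theory Num.Theory.
Import numFieldNormedType.Exports.
Local Open Scope classical_set_scope.
Local Open Scope ring_scope.
Set Implicit Arguments.
Unset Strict Implicit.

(** Expand everything in the Dirichlet eigenfunctions and write m_j for the
    square root of lam_j, c_j and d_j for the coefficients of the exact data
    up0 and of the noise, a_j = mu lam_j^-(sigma+1) for the eigenvalues of A,
    E_j(y) for E_{alpha,1}(- m_j y^alpha) and rho_j(y) = exp(- m_j y) / E_j(y).
    Landweber iteration multiplies the j-th coefficient by
    q_j = 1 - (1 - a_j)^i, so the j-th coefficient of the error at height y is

      c_j exp(m_j y) (1 - q_j rho_j(y)) - q_j d_j / E_j(y).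

    (The stable components cancel, because testing the weak formulation with
    phi_j gives the ordinary differential equation w'' = lam_j w.)

    Noise term: 1 / E_j(y) <= 1 + Gamma(1 - alpha) m_j y^alpha grows with m_j,
    but q_j^2 <= q_j <= i a_j decays like lam_j^-(sigma+1), which is exactly
    what the weight lam_j^sigma and the factor m_j^2 cost. With Bessel's
    inequality the squared noise is at most a constant times
    i delta^2 (1 + Gamma(1 - alpha)^2). Here i delta^2 tends to 0 and is of the
    order of the square of the smoothed noise level, so the hypothesis on
    Gamma(1 - alpha) makes the product vanish.

    Approximation term: q_j rho_j(y) tends to 1 uniformly in y for every fixed
    j, while (1 - q_j rho_j(y))^2 <= const lam_j^(1 + 1/p) for all j and y at
    once. The a priori regularity of the unstable component says that
    lam_j^(sigma + 1 + 1/p) (c_j exp(m_j y))^2 is summable and integrable, so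
    the term vanishes by dominated convergence; no rate is needed, neither for
    the Landweber filter nor for alpha.

    The analytic core is thus a set of bounds for E_{alpha,1}(-x), x >= 0:
      exp(- x / Gamma(1 + alpha)) <= E_{alpha,1}(-x),
      1 / (1 + Gamma(1 - alpha) x) <= E_{alpha,1}(-x),
      E_{alpha,1}(-x) <= exp(- x / Gamma(1 + alpha)) + O((1 - alpha) x^2).
    They express that E_{alpha,1}(-x) is the Laplace transform of a probability
    law with mean 1 / Gamma(1 + alpha) and second moment
    2 / Gamma(1 + 2 alpha): the first is Jensen's inequality and the last one
    is a second order Taylor bound, where the variance is small for alpha near
    1. The law is approached by a discrete one. For 0 < alpha < 1 the power
    series 1 - (1 - z)^alpha has nonnegative coefficients with sum 1, that is,
    it is the law of the gaps of a renewal process; the number of renewals up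
    to time n has binomial moments given by coefficients of powers of 1 - z,
    and on the scale n^alpha these converge to values of 1 / Gamma by Gauss's
    product formula, which follows from the log-convexity of Gamma (Wendel).
    All three bounds hold for the renewal process by short inductions and pass
    to the limit.

    For the uniform domination of rho_j there are two regimes: if
    m_j (1 - alpha) <= 1 the Jensen bound shows that rho_j is bounded, and
    otherwise Gamma(1 - alpha) <= 1 / (1 - alpha) < m_j turns the rational
    bound into rho_j <= 1 + m_j^(2 - alpha). *)

(** * Euler's integral *)

Section gamma.
Context {R : realType}.
Implicit Types (x s t K : R) (n : nat).

Notation leb := (@lebesgue_measure R).

Definition gamma_integrand x t : R := t `^ (x - 1) * expR (- t).

Lemma gamma_integrand_ge0 x t : 0 <= gamma_integrand x t.
Proof. by rewrite mulr_ge0 ?powR_ge0 ?expR_ge0. Qed.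

Lemma measurable_gamma_integrand x (D : set R) :
  measurable_fun D (fun t : R => (gamma_integrand x t)%:E).
Proof.
apply: measurable_funTS; apply/measurable_EFinP.
apply: measurable_funM; first exact: measurable_powR.
by apply: measurableT_comp => //.
Qed.

(** The extended real value of Euler's integral: it allows passing to limits
    of integrals before the integral is known to be finite. *)
Definition eGamma x : \bar R :=
  (\int[leb]_(t in `]0%R, +oo[) (gamma_integrand x t)%:E)%E.

Lemma eGamma_ge0 x : (0 <= eGamma x)%E.
Proof. by apply: integral_ge0 => t _; rewrite lee_fin gamma_integrand_ge0. Qed.

Lemma is_derive_NexpRN t : is_derive t 1 (fun r : R => - expR (- r)) (expR (- t)).
Proof. apply: is_derive_eq; by rewrite -?mulr_algl ?mulrN1 ?opprK. Qed.

Lemma derivable1_continuous (f : R -> R) t : derivable f t 1 -> {for t, continuous f}.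
Proof. by move=> df; apply/differentiable_continuous; rewrite -derivable1_diffP. Qed.

Lemma integral_expRN K :
  (\int[leb]_(t in `[K, +oo[) (expR (- t))%:E)%E = (expR (- K))%:E.
Proof.
rewrite (@ge0_continuous_FTC2y R (fun t => expR (- t)) (fun t => - expR (- t)) K 0).
- by rewrite sub0e EFinN oppeK.
- by move=> t _; exact: expR_ge0.
- by apply: derivable_within_continuous => t _.
- by rewrite -[0]oppr0; apply: cvgN; exact: cvgr_expR.
- by move=> t _; exact: ex_derive.
- apply: cvg_at_right_filter.
  by apply: (@derivable1_continuous (fun r => - expR (- r))); exact: ex_derive.
- by move=> t _; rewrite derive1E; apply: derive_val; exact: is_derive_NexpRN.
Qed.

Let exhaust n : set R := `[n.+2%:R^-1, n.+2%:R].

Let exhaust_lt n : n.+2%:R^-1 < n.+2%:R :> R.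
Proof.
by rewrite (@lt_trans _ _ 1) ?invf_lt1 ?ltr1n// ltr0n.
Qed.

(** Compact intervals avoid the singularity at 0 for x < 1, so that integration
    by parts applies on them. *)
Lemma eGamma_lim x :
  (\int[leb]_(t in exhaust n) (gamma_integrand x t)%:E)%E @[n --> \oo]
    --> eGamma x.
Proof.
rewrite /eGamma (_ : `]0%R, +oo[%classic = \bigcup_n exhaust n); last first.
  apply/seteqP; split => t /=.
    rewrite in_itv/= andbT => t0.
    have t1 : 0 <= t^-1 by rewrite invr_ge0 ltW.
    have H1 := archi_boundP t1; have H2 := archi_boundP (ltW t0).
    set a := Num.bound _ in H1; set b := Num.bound _ in H2.
    exists (a + b)%N => //=; rewrite /exhaust /= in_itv /=; apply/andP; split.
      rewrite -[leRHS]invrK lef_pV2 ?posrE ?invr_gt0 ?ltr0n//.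
      by rewrite (le_trans (ltW H1))// ler_nat -addn2 -addnA leq_addr.
    by rewrite (le_trans (ltW H2))// ler_nat -addn2 addnAC leq_addl.
  move=> [n _]; rewrite /exhaust /= !in_itv/= andbT => /andP[+ _].
  by apply: lt_le_trans; rewrite invr_gt0 ltr0n.
apply: ge0_nondecreasing_set_cvg_integral => //.
- apply/nondecreasing_seqP => n; apply/subsetPset => t /=.
  rewrite /exhaust /= !in_itv/= => /andP[a b]; apply/andP; split.
    by rewrite (le_trans _ a)// lef_pV2 ?posrE ?ltr0n// ler_nat.
  by rewrite (le_trans b)// ler_nat.
- by move=> i; exact: measurable_itv.
- by move=> i; exact: (@measurable_gamma_integrand x (exhaust i)).
- by move=> i t _; rewrite lee_fin gamma_integrand_ge0.
Qed.

Lemma powR_expRN_le x (k : nat) t : x <= k%:R -> 1 <= t ->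
  t `^ x * expR (- t) <= k.+1`!%:R / t.
Proof.
move=> xk t1; have t0 : 0 < t by exact: lt_le_trans t1.
rewrite ler_pdivlMr// mulrAC expRN ler_pdivrMr ?expR_gt0//.
have h : t `^ x * t <= t ^+ k.+1.
  rewrite exprSr ler_wpM2r ?(ltW t0)//.
  by rewrite -powR_mulrn ?(ltW t0)// ler_powR.
apply: (le_trans h); have := expR_ge1Dxn k (ltW t0).
rewrite -lerBrDl => /le_trans - /(_ (expR t)).
rewrite ler_pdivrMr ?ltr0n ?fact_gt0// mulrC; apply.
by rewrite gerBl.
Qed.

(** Integration by parts on [1/n, n]; the boundary terms t^x exp(-t) vanish at
    both ends since x > 0. As an identity in the extended reals it also
    propagates finiteness. *)
Lemma eGamma_rec x : 0 < x -> eGamma (x + 1) = (x%:E * eGamma x)%E.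
Proof.
move=> x0.
pose r n : R := n.+2%:R^-1 `^ x * expR (- n.+2%:R^-1)
  - n.+2%:R `^ x * expR (- n.+2%:R).
have IBP n : (\int[leb]_(t in exhaust n) (gamma_integrand (x + 1) t)%:E
   = (r n)%:E + x%:E * \int[leb]_(t in exhaust n) (gamma_integrand x t)%:E)%E.
  set a : R := n.+2%:R^-1; set b : R := n.+2%:R.
  have a0 : 0 < a by rewrite invr_gt0.
  have pos t : t \in `[a, b] -> 0 < t.
    by rewrite in_itv/= => /andP[+ _]; apply: lt_le_trans.
  have poso t : t \in `]a, b[ -> 0 < t.
    by move=> h; apply: pos; exact: subset_itv_oo_cc.
  have dP y t : 0 < t -> derivable (@powR R ^~ y) t 1.
    by move=> t0; apply: derivable_powR; rewrite in_itv/= t0.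
  have dE t : derivable (fun t => - expR (- t)) t 1 by exact: ex_derive.
  have b0 : 0 < b by rewrite ltr0n.
  have LR (f : R -> R) : (forall t, 0 < t -> derivable f t 1) ->
      derivable_oo_LRcontinuous f a b.
    move=> df; split; first by move=> t /poso/df.
    - by apply: cvg_at_right_filter; exact/derivable1_continuous/df.
    - by apply: cvg_at_left_filter; exact/derivable1_continuous/df.
  rewrite /exhaust -/a -/b.
  transitivity (\int[leb]_(t in `[a, b]) (t `^ x * expR (- t))%:E)%E.
    by apply: eq_integral => t _; rewrite /gamma_integrand addrK.
  rewrite (@integration_by_parts R (@powR R ^~ x) (fun t => - expR (- t))
    (fun t => x * t `^ (x - 1)) (fun t => expR (- t)) a b (exhaust_lt n)).
  - rewrite (_ : (fun _ => _) = (fun t => - (x%:E * (gamma_integrand x t)%:E))%E);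
      last first.
      apply/funext => t; rewrite /gamma_integrand -!(EFinN, EFinM).
      by congr EFin; ring.
    rewrite integral_ge0N; last first.
      by move=> t _; rewrite -EFinM lee_fin mulr_ge0 ?(ltW x0)// gamma_integrand_ge0.
    rewrite oppeK ge0_integralZl//=; last 3 first.
    + exact: measurable_gamma_integrand.
    + by move=> t _; rewrite lee_fin gamma_integrand_ge0.
    + by rewrite lee_fin ltW.
    by congr (_%:E + _)%E; rewrite /r -/a -/b; ring.
  - apply: derivable_within_continuous => t /pos t0.
    apply: derivableM; first exact: derivable_cst.
    exact: dP.
  - by apply: LR => t t0; exact: dP.
  - move=> t /poso t0; rewrite powR_derive1// in_itv/= t0//.
  - by apply: derivable_within_continuous => t _.
  - by apply: LR => t _; exact: dE.
  - move=> t /poso t0; rewrite derive1E; apply: derive_val; exact: is_derive_NexpRN.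
have r0 : r n @[n --> \oo] --> (0 : R).
  have inv0 : (n.+2%:R^-1 : R) @[n --> \oo] --> (0 : R).
    by have := @cvg_harmonic R; rewrite -cvg_shiftS.
  have h1 : (n.+2%:R^-1 : R) `^ x @[n --> \oo] --> (0 : R).
    have /cvg_at_rightP := powR_cvg0 x0; apply; split => // n.
  rewrite -[0](subr0 0); apply: cvgB.
    apply: (squeeze_cvgr _ (cvg_cst 0) h1); near=> n.
    rewrite mulr_ge0 ?powR_ge0 ?expR_ge0//= ler_piMr ?powR_ge0 ?expR_le1 ?oppr_le0 ?invr_ge0//.
  set k := Num.bound x.
  have h2 : (k.+1`!%:R / n.+2%:R : R) @[n --> \oo] --> (0 : R).
    by rewrite -[0](mulr0 (k.+1`!%:R)); apply: cvgM => //; exact: cvg_cst.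
  apply: (squeeze_cvgr _ (cvg_cst 0) h2); near=> n.
  rewrite mulr_ge0 ?powR_ge0 ?expR_ge0//= powR_expRN_le ?ler1n//.
  by apply/ltW/archi_boundP/ltW.
have H1 := @eGamma_lim (x + 1).
have H2 : ((r n)%:E + x%:E * \int[leb]_(t in exhaust n) (gamma_integrand x t)%:E)%E
    @[n --> \oo] --> (0 + x%:E * eGamma x)%E.
  apply: cvgeD; first by rewrite fin_num_adde_defr.
    by apply: cvg_EFin; [exact: nearW|exact: r0].
  by apply: cvgeZl => //; exact: eGamma_lim.
rewrite add0e in H2.
move: H1; under eq_fun do rewrite IBP.
by move=> /cvg_unique; apply.
Unshelve. all: by end_near. Qed.

Lemma eGamma1 : eGamma 1 = 1%E.
Proof.
rewrite /eGamma; transitivity (\int[leb]_(t in `]0%R, +oo[) (expR (- t))%:E)%E.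
  by apply: eq_integral => t _; rewrite /gamma_integrand subrr powRr0 mul1r.
rewrite integral_itv_obnd_cbnd; last first.
  apply/measurable_funTS/measurable_EFinP.
  by apply: measurableT_comp.
by rewrite integral_expRN oppr0 expR0.
Qed.

(** The integers follow from the recurrence, a large x is compared with the next
    integer, and a small x is reached by the recurrence again. *)
Lemma eGamma_lty x : 0 < x -> (eGamma x < +oo)%E.
Proof.
move=> x0.
have fact_lty (n : nat) : (eGamma n.+1%:R < +oo)%E.
  elim: n => [|n IH]; first by rewrite eGamma1 ltry.
  by rewrite -natr1 eGamma_rec// lte_mul_pinfty.
suff : (eGamma (x + 1) < +oo)%E.
  rewrite eGamma_rec//; case: (eGamma x) (eGamma_ge0 x) => [r _ _|_|].
  - exact: ltry.
  - by rewrite mulry gtr0_sg// mul1e.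
  - by [].
set n := Num.bound x.
have xn : x < n%:R by exact/archi_boundP/ltW.
apply: (@le_lt_trans _ _ (eGamma 1 + eGamma n.+1%:R)%E); last first.
  by rewrite lte_add_pinfty// eGamma1 ltry.
rewrite /eGamma -ge0_integralD//=; last 4 first.
- by move=> t _; rewrite lee_fin gamma_integrand_ge0.
- exact: measurable_gamma_integrand.
- by move=> t _; rewrite lee_fin gamma_integrand_ge0.
- exact: measurable_gamma_integrand.
apply: ge0_le_integral => //=.
- by move=> t _; rewrite lee_fin gamma_integrand_ge0.
- exact: measurable_gamma_integrand.
- by apply: emeasurable_funD; exact: measurable_gamma_integrand.
move=> t; rewrite in_itv/= andbT => t0.
rewrite -EFinD lee_fin -mulrDl ler_wpM2r ?expR_ge0//.
rewrite addrK subrr powRr0 -natr1 addrK.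
have [t1|t1] := leP t 1.
  apply: (@le_trans _ _ (1 `^ x)); last by rewrite powR1 lerDl powR_ge0.
  by rewrite ge0_ler_powR ?nnegrE// ltW.
apply: (@le_trans _ _ (t `^ n%:R)); last by rewrite lerDr.
by rewrite ler_powR ?(ltW t1)// ltW.
Qed.

Lemma eGammaE x : 0 < x -> eGamma x = (Gamma x)%:E.
Proof.
by move=> x0; rewrite -[LHS]fineK// ge0_fin_numE ?eGamma_ge0 ?eGamma_lty.
Qed.

Lemma Gamma1 : Gamma 1 = 1 :> R.
Proof. by apply: EFin_inj; rewrite -eGammaE// eGamma1. Qed.

Lemma Gamma_rec x : 0 < x -> Gamma (x + 1) = x * Gamma x.
Proof.
move=> x0; apply: EFin_inj.
by rewrite -eGammaE ?addr_gt0// eGamma_rec// eGammaE// EFinM.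
Qed.

(** Restrict the integral to t >= K. Letting K grow shows that Gamma outgrows
    every exponential, which gives the Mittag-Leffler series an infinite radius
    of convergence. *)
Lemma Gamma_ge_powR K y : 0 <= K -> 0 <= y -> K `^ y * expR (- K) <= Gamma (y + 1).
Proof.
move=> K0 y0; rewrite -lee_fin -eGammaE ?ltr_wpDl//.
have -> : (K `^ y * expR (- K))%:E =
    (\int[leb]_(t in `[K, +oo[) ((K `^ y)%:E * (expR (- t))%:E))%E.
  rewrite EFinM -integral_expRN; apply/esym/ge0_integralZl_EFin => //.
  - apply/measurable_funTS/measurable_EFinP.
    by apply: measurableT_comp.
  - exact: powR_ge0.
rewrite /eGamma integral_itv_obnd_cbnd; last exact: measurable_gamma_integrand.
apply: (@le_trans _ _ (\int[leb]_(t in `[K, +oo[) (gamma_integrand (y + 1) t)%:E)%E).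
  apply: ge0_le_integral => //=.
  - by move=> t _; rewrite lee_fin mulr_ge0 ?powR_ge0 ?expR_ge0.
  - apply/measurable_funTS/measurable_EFinP.
    by apply: measurable_funM => //; apply: measurableT_comp.
  - exact: measurable_gamma_integrand.
  move=> t; rewrite in_itv/= andbT => Kt.
  rewrite lee_fin /gamma_integrand addrK ler_wpM2r ?expR_ge0//.
  by rewrite ge0_ler_powR ?nnegrE// (le_trans K0).
apply: ge0_subset_integral => //=.
- exact: measurable_gamma_integrand.
- by move=> t _; rewrite lee_fin gamma_integrand_ge0.
by move=> t /=; rewrite !in_itv/= !andbT; exact: le_trans.
Qed.

Lemma Gamma_gt0 x : 0 < x -> 0 < Gamma x.
Proof.
move=> x0; rewrite -(pmulr_rgt0 _ x0) -Gamma_rec//.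
apply: lt_le_trans (@Gamma_ge_powR 1 x ler01 (ltW x0)).
by rewrite mulr_gt0 ?powR_gt0 ?expR_gt0.
Qed.

(** The concave function t^s lies below its tangent at 1. *)
Lemma powR_le_tangent s t : 0 <= s <= 1 -> 0 < t -> t `^ s <= 1 - s + s * t.
Proof.
move=> /andP[s0 s1] t0.
rewrite /powR (gt_eqF t0); set u := ln t.
rewrite (_ : s * t = s * expR u); last by rewrite lnK.
have tan v : expR (s * u) * (1 + v - s * u) <= expR v.
  rewrite [v in leRHS](_ : v = s * u + (v - s * u)); last by rewrite subrKC.
  by rewrite expRD ler_pM2l ?expR_gt0// -addrA expR_ge1Dx.
have h0 := ler_wpM2l (_ : 0 <= 1 - s) (tan 0).
have h1 := ler_wpM2l s0 (tan u).
rewrite subr_ge0 in h0; have := lerD (h0 s1) h1; rewrite expR0 mulr1.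
by apply: le_trans; rewrite le_eqVlt; apply/orP; left; apply/eqP; ring.
Qed.

(** Log-convexity of Gamma between x and x + 1: integrate the tangent inequality
    (t / x)^s <= 1 - s + s t / x against t^(x-1) exp(-t). All the information on
    the size of Gamma below comes from this inequality and the recurrence. *)
Lemma Wendel x s : 0 < x -> 0 <= s <= 1 -> Gamma (x + s) <= x `^ s * Gamma x.
Proof.
move=> x0 s01; have /andP[s0 s1] := s01.
have xs0 : 0 < x + s by rewrite ltr_pwDl.
have x10 : 0 < x + 1 by rewrite addr_gt0.
have -> : x `^ s * Gamma x =
    x `^ s * (1 - s) * Gamma x + x `^ s * s / x * Gamma (x + 1).
  by rewrite Gamma_rec//; field; rewrite gt_eqF.
set a := x `^ s * (1 - s); set b := x `^ s * s / x.
rewrite -lee_fin EFinD (EFinM a) (EFinM b) -!eGammaE//.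
have c1 : 0 <= a by rewrite mulr_ge0 ?powR_ge0 ?subr_ge0.
have c2 : 0 <= b by rewrite divr_ge0 ?mulr_ge0 ?powR_ge0 ?(ltW x0).
have nn y t : (0 <= (gamma_integrand y t)%:E)%E by rewrite lee_fin gamma_integrand_ge0.
have mm y := @measurable_gamma_integrand y `]0%R, +oo[.
have mZ (c y : R) : measurable_fun (`]0%R, +oo[%classic : set R)
    (fun t : R => c%:E * (gamma_integrand y t)%:E)%E.
  by apply: measurable_funeM.
have Z c y : 0 <= c -> (c%:E * eGamma y =
    \int[leb]_(t in `]0%R, +oo[) (c%:E * (gamma_integrand y t)%:E))%E.
  move=> c0; apply/esym/ge0_integralZl_EFin => //.
  exact: measurable_gamma_integrand.
rewrite !Z//.
have Za (c y : R) : 0 <= c -> forall t : R, `]0%R, +oo[%classic t ->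
    (0 <= c%:E * (gamma_integrand y t)%:E)%E.
  by move=> c0 t _; rewrite mule_ge0.
rewrite [leRHS](_ : _ = \int[leb]_(t in `]0%R, +oo[)
    (a%:E * (gamma_integrand x t)%:E + b%:E * (gamma_integrand (x + 1) t)%:E))%E; last first.
  apply/esym/ge0_integralD => //; [exact: Za|exact: mZ|exact: Za|exact: mZ].
apply: ge0_le_integral => //=.
- exact: measurable_gamma_integrand.
- by apply: emeasurable_funD; exact: mZ.
move=> t; rewrite in_itv/= andbT => t0.
rewrite -!EFinM -EFinD lee_fin /gamma_integrand (mulrA a) (mulrA b) -mulrDl ler_wpM2r ?expR_ge0//.
have -> : x + s - 1 = (x - 1) + s by ring.
rewrite addrK powRD; last by rewrite (gt_eqF t0) implybT.
have -> : t `^ x = t `^ (x - 1) * t.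
  rewrite -[X in _ = _ * X]powRr1 ?(ltW t0)// -powRD ?subrK//.
  by rewrite (gt_eqF t0) implybT.
have := @powR_le_tangent s (t / x) s01 (divr_gt0 t0 x0).
rewrite powRM ?invr_ge0 ?(ltW t0) ?(ltW x0)// -powR_inv1 ?(ltW x0)// powRAC.
rewrite powR_inv1 ?powR_ge0// powR_inv1 ?(ltW x0)//.
rewrite ler_pdivrMr ?powR_gt0// => /(ler_wpM2l (powR_ge0 t (x - 1))) /le_trans; apply.
by rewrite le_eqVlt; apply/orP; left; apply/eqP; rewrite /a /b; field; rewrite gt_eqF.
Qed.
End gamma.

(** * The renewal process with gap law 1 - (1 - z)^a *)

Section renewal.
Context {R : realType}.
Implicit Types (s t c : R) (n k m : nat) (phi : nat -> R).

(** The coefficient of z^n in (1 - z)^(-s). *)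
Definition negbin n s : R := \prod_(i < n) ((s + i%:R) / i.+1%:R).

Lemma negbinS n s : negbin n.+1 s * n.+1%:R = negbin n s * (s + n%:R).
Proof.
by rewrite /negbin big_ord_recr /= -mulrA divfK// pnatr_eq0.
Qed.

Lemma negbin0 s : negbin 0 s = 1. Proof. by rewrite /negbin big_ord0. Qed.

Lemma negbinN1 n : negbin n 1 = 1.
Proof.
rewrite /negbin big1// => i _.
by rewrite -[X in X + _]/(1%:R) -natrD add1n divff// pnatr_eq0.
Qed.

(** The product of (1 - z)^(-s) and (1 - z)^(-t) is (1 - z)^(-s-t). The induction
    uses the Euler operator z d/dz: split n + 1 as i + (n + 1 - i) in front of
    the sum and apply the first order recurrence to either factor. *)
Lemma negbin_Vandermonde n s t :
  \sum_(i < n.+1) negbin i s * negbin (n - i) t = negbin n (s + t).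
Proof.
elim: n => [|n IH]; first by rewrite big_ord1 !negbin0 mulr1.
have n0 : n.+1%:R != 0 :> R by rewrite pnatr_eq0.
apply: (mulIf n0); rewrite negbinS -IH big_distrl /= mulr_suml.
transitivity (\sum_(i < n.+2) (negbin i s * i%:R * negbin (n.+1 - i) t) +
    \sum_(i < n.+2) (negbin i s * (negbin (n.+1 - i) t * (n.+1 - i)%:R))).
  rewrite -big_split /=; apply: eq_bigr => i _.
  have -> : n.+1%:R = i%:R + (n.+1 - i)%:R :> R.
    by rewrite -natrD subnKC// -ltnS.
  ring.
rewrite big_ord_recl /= mulr0 mul0r add0r [X in _ + X]big_ord_recr /=.
rewrite subnn mulr0 mulr0 addr0 -big_split /=; apply: eq_bigr => i _.
rewrite /bump /= add1n negbinS subSS subSn -1?ltnS// negbinS.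
have -> : n%:R = i%:R + (n - i)%:R :> R by rewrite -natrD subnKC// -ltnS.
ring.
Qed.

Variable a : R.
Hypothesis a01 : 0 < a < 1.

(** The probability that the gap between two renewals equals n + 1, that is, the
    coefficient of z^(n+1) in 1 - (1 - z)^a. *)
Definition jump n : R := - negbin n.+1 (- a).
(** The probability that a gap exceeds n, that is, the coefficient of z^n in
    (1 - z)^(a-1). *)
Definition survival n : R := negbin n (1 - a).

Let a0 : 0 < a. Proof. by have /andP[] := a01. Qed.
Let a1 : a < 1. Proof. by have /andP[] := a01. Qed.

Lemma jump_ge0 n : 0 <= jump n.
Proof.
elim: n => [|n IH].
  by rewrite /jump /negbin big_ord1 /= addr0 divr1 opprK ltW.
rewrite -(pmulr_lge0 _ (ltr0Sn R n.+1)) /jump mulNr negbinS -mulNr mulr_ge0//.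
by rewrite addrC subr_ge0 (le_trans (ltW a1))// ler1n.
Qed.

Lemma survival_gt0 n : 0 < survival n.
Proof.
apply: prodr_gt0 => i _; rewrite divr_gt0// ltr_wpDr// subr_gt0//.
Qed.

Lemma survivalS n : survival n.+1 <= survival n.
Proof.
rewrite -(ler_pM2r (ltr0Sn R n)) negbinS ler_wpM2l ?(ltW (survival_gt0 n))//.
by rewrite -natr1 addrC lerD2l gerBl ltW.
Qed.

(** The coefficients of (1 - z)^a (1 - z)^(-t) = (1 - z)^(a-t), in the form of a
    renewal equation. *)
Lemma negbin_renewal n t :
  negbin n t = negbin n (t - a) + \sum_(i < n) jump i * negbin (n - i.+1) t.
Proof.
have := negbin_Vandermonde n (- a) t.
rewrite big_ord_recl negbin0 mul1r subn0 => h.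
rewrite addrC [- a + t]addrC in h.
rewrite -{}h -addrA addrCA  -big_split /= big1 ?addr0// => i _.
by rewrite /bump /= add1n /jump mulNr subrr.
Qed.

(** The probability of exactly k renewals up to time n. *)
Fixpoint renewal k n : R :=
  if k is k'.+1 then \sum_(i < n) jump i * renewal k' (n - i.+1)
  else survival n.

Lemma renewal_ge0 k n : 0 <= renewal k n.
Proof.
elim: k n => [|k IH] n /=; first exact: ltW (survival_gt0 n).
by apply: sumr_ge0 => i _; rewrite mulr_ge0 ?jump_ge0.
Qed.

Lemma renewal_eq0 k n : (n < k)%N -> renewal k n = 0.
Proof.
elim: k n => [//|k IH] n nk /=; rewrite big1// => i _; rewrite IH ?mulr0//.
by rewrite (leq_trans _ (_ : n <= k)%N)// ltn_subrL (leq_ltn_trans _ (ltn_ord i)).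
Qed.

(** The expectation of phi(number of renewals up to time n); there are at most n
    renewals. *)
Definition renewal_mean n phi : R := \sum_(k < n.+1) renewal k n * phi k.

Lemma renewal_mean_widen n m phi : (n < m)%N ->
  renewal_mean n phi = \sum_(k < m) renewal k n * phi k.
Proof.
move=> nm; rewrite /renewal_mean (big_ord_widen m (fun k => renewal k n * phi k))//.
rewrite big_mkcond /=; apply: eq_bigr => i _; case: ltnP => // ni.
by rewrite renewal_eq0 ?mul0r.
Qed.

(** Condition on the first renewal. *)
Lemma renewal_mean_rec n phi : renewal_mean n phi =
  survival n * phi 0%N + \sum_(i < n) jump i * renewal_mean (n - i.+1) (phi \o succn).
Proof.
rewrite /renewal_mean big_ord_recl /=; congr (_ + _).
under eq_bigr do rewrite mulr_suml.
rewrite exchange_big /=; apply: eq_bigr => i _.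
rewrite -[X in _ * X]/(renewal_mean (n - i.+1) (phi \o succn)) (@renewal_mean_widen _ n).
  by rewrite mulr_sumr; apply: eq_bigr => k _; rewrite /bump /= add1n mulrA.
by rewrite ltn_subrL (leq_ltn_trans _ (ltn_ord i)).
Qed.

Lemma eq_renewal_mean n phi psi : phi =1 psi -> renewal_mean n phi = renewal_mean n psi.
Proof. by move=> e; apply: eq_bigr => k _; rewrite e. Qed.

Lemma renewal_meanD n phi psi :
  renewal_mean n (fun k => phi k + psi k) = renewal_mean n phi + renewal_mean n psi.
Proof. by rewrite /renewal_mean -big_split /=; apply: eq_bigr => k _; rewrite mulrDr. Qed.

Lemma renewal_meanZ n c phi :
  renewal_mean n (fun k => c * phi k) = c * renewal_mean n phi.
Proof. by rewrite /renewal_mean mulr_sumr; apply: eq_bigr => k _; rewrite mulrCA. Qed.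

Lemma renewal_mean_sum n m (F : nat -> nat -> R) :
  renewal_mean n (fun k => \sum_(j < m) F j k) = \sum_(j < m) renewal_mean n (F j).
Proof.
rewrite /renewal_mean exchange_big /=; apply: eq_bigr => k _.
by rewrite mulr_sumr.
Qed.

Lemma le_renewal_mean n phi psi : (forall k, phi k <= psi k) ->
  renewal_mean n phi <= renewal_mean n psi.
Proof. by move=> h; apply: ler_sum => k _; rewrite ler_wpM2l ?renewal_ge0. Qed.

(** The generating function in n of these moments is (1 - z)^(-am-1): by Pascal's
    rule and conditioning on the first renewal both sides satisfy the same
    renewal equation, with the moments of order m - 1 as the source. *)
Lemma renewal_moment n m :
  renewal_mean n (fun k => 'C(k + m, m)%:R) = negbin n (a * m%:R + 1).
Proof.
elim: m n => [|m IHm] n.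
  rewrite mulr0 add0r; elim/ltn_ind: n => n IHn.
  rewrite renewal_mean_rec bin0 mulr1 negbin_renewal; congr (_ + _).
  apply: eq_bigr => i _; congr (_ * _).
  rewrite -IHn; first by apply: eq_renewal_mean => k /=; rewrite !bin0.
  by rewrite ltn_subrL (leq_ltn_trans _ (ltn_ord i)).
elim/ltn_ind: n => n IHn.
rewrite negbin_renewal (_ : _ - a = a * m%:R + 1); last by rewrite -natr1; ring.
rewrite -IHm renewal_mean_rec [in RHS]renewal_mean_rec !add0n !binn.
rewrite -addrA; congr (_ + _); rewrite -big_split /=; apply: eq_bigr => i _.
rewrite -mulrDr; congr (_ * _).
rewrite -IHn; last by rewrite ltn_subrL (leq_ltn_trans _ (ltn_ord i)).
rewrite -renewal_meanD; apply: eq_renewal_mean => k /=.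
by rewrite (_ : (k.+1 + m.+1 = (k + m.+1).+1)%N)// binS natrD addrC addSnnS.
Qed.

Lemma renewal_mean_cst n c : renewal_mean n (fun=> c) = c.
Proof.
have := renewal_moment n 0; rewrite mulr0 add0r negbinN1 => h.
rewrite -[RHS]mulr1 -[in RHS]h -renewal_meanZ.
by apply: eq_renewal_mean => k; rewrite bin0 mulr1.
Qed.

Lemma sum_jump n : \sum_(i < n) jump i = 1 - survival n.
Proof.
have := negbin_renewal n 1; rewrite negbinN1 => h.
rewrite [in RHS]h /survival addrAC subrr add0r; apply: eq_bigr => i _.
by rewrite negbinN1 mulr1.
Qed.

(** The discrete counterpart of E_{a,1}(-x); geometric weights are used instead
    of exponential ones because their expansion in c involves exactly the
    binomial moments. *)
Definition renewal_gf n c : R := renewal_mean n (fun k => (1 + c)^-1 ^+ k.+1).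

(** Each gap exceeds n with probability survival n, so 1 + (number of renewals)
    is dominated by a geometric variable, whose generating function is the left
    hand side. The induction needs that the bound decreases in n. *)
Lemma renewal_gf_ge_survival n c : 0 <= c ->
  survival n / (survival n + c) <= renewal_gf n c.
Proof.
move=> c0; elim/ltn_ind: n => n IH.
have c1 : 0 < 1 + c by rewrite ltr_pwDl.
have sc m : 0 < survival m + c by rewrite ltr_pwDl ?survival_gt0.
set v := _ / _.
have mono m : (m <= n)%N -> v <= survival m / (survival m + c).
  move=> mn; rewrite /v ler_pdivrMr// mulrAC ler_pdivlMr//.
  have : survival n <= survival m.
    by apply: (@nonincreasing_seqP _ _ survival).1 => //; exact: survivalS.
  rewrite -subr_ge0 => h; rewrite -subr_ge0.
  rewrite (_ : _ - _ = c * (survival m - survival n)); last by ring.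
  exact: mulr_ge0.
rewrite /renewal_gf renewal_mean_rec expr1.
have -> : \sum_(i < n) jump i *
    renewal_mean (n - i.+1) ((fun k => (1 + c)^-1 ^+ k.+1) \o succn) =
    (1 + c)^-1 * \sum_(i < n) jump i * renewal_gf (n - i.+1) c.
  rewrite mulr_sumr; apply: eq_bigr => i _; rewrite mulrCA; congr (_ * _).
  by rewrite -renewal_meanZ; apply: eq_renewal_mean => k /=; rewrite exprS.
rewrite (mulrC (survival n)) -mulrDr mulrC ler_pdivlMr//.
apply: (@le_trans _ _ (survival n + v * (1 - survival n))).
  rewrite le_eqVlt; apply/orP; left; apply/eqP; rewrite /v; field.
  by rewrite gt_eqF.
rewrite lerD2l -sum_jump mulr_sumr; apply: ler_sum => i _.
rewrite mulrC ler_wpM2l ?jump_ge0//.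
have lt : (n - i.+1 < n)%N by rewrite ltn_subrL (leq_ltn_trans _ (ltn_ord i)).
by rewrite (le_trans (mono _ (ltnW lt)))// IH.
Qed.

Lemma renewal_mean_succ n :
  renewal_mean n (fun k => k.+1%:R) = negbin n (a + 1).
Proof.
rewrite -[a in RHS]mulr1 -[1 in X in X + _]/(1%:R) -renewal_moment.
by apply: eq_renewal_mean => k; rewrite addn1 bin1.
Qed.

Lemma renewal_mean_succ_sqr_le n :
  renewal_mean n (fun k => k.+1%:R ^+ 2) <= 2 * negbin n (a * 2 + 1).
Proof.
rewrite -[2 in X in X + 1]/(2%:R) -renewal_moment -renewal_meanZ.
apply: le_renewal_mean => k.
rewrite -natrX -natrM ler_nat addn2 mulnC; have := bin2 k.+2.
have := odd_double_half (k.+2 * k.+1); rewrite oddM /= andNb add0n => h ->.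
by rewrite muln2 h -mulnn leq_mul2r leqnSn orbT.
Qed.

(** Jensen's inequality, in the form of the tangent to exp at the mean. *)
Lemma renewal_gf_ge_exp n c : 0 <= c ->
  expR (- (c * negbin n (a + 1))) <= renewal_gf n c.
Proof.
move=> c0; set M := negbin n (a + 1).
pose lin k : R := expR (- (c * M)) * (1 + c * M) + - (expR (- (c * M)) * c) * k.+1%:R.
have -> : expR (- (c * M)) = renewal_mean n lin.
  rewrite renewal_meanD renewal_mean_cst renewal_meanZ renewal_mean_succ -/M; ring.
apply: le_renewal_mean => k.
apply: (@le_trans _ _ (expR (- (c * k.+1%:R)))).
  have -> : lin k = expR (- (c * M)) * (1 + (c * M - c * k.+1%:R)) by rewrite /lin; ring.
  rewrite [X in _ <= expR X](_ : _ = - (c * M) + (c * M - c * k.+1%:R)); last by ring.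
  by rewrite expRD ler_pM2l ?expR_gt0// expR_ge1Dx.
have c1 : 0 < 1 + c by rewrite ltr_pwDl.
rewrite -mulNr expRM_natr lerXn2r ?nnegrE ?expR_ge0 ?invr_ge0 ?(ltW c1)//.
by rewrite expRN lef_pV2 ?posrE ?expR_gt0// expR_ge1Dx.
Qed.

(** For v = m - r <= 1/2 the bound exp(v) <= 1 / (1 - v) <= 1 + v + 2 v^2
    suffices; for larger v the quadratic term alone exceeds exp(-r) <= 1. *)
Lemma expRN_le_quadratic (r m : R) : 0 <= r -> 0 <= m ->
  expR (- r) <= expR (- m) * (1 + (m - r)) + 4 * (m - r) ^+ 2.
Proof.
move=> r0 m0; set v := m - r.
have [v2|v2] := leP v 2^-1; last first.
  apply: (@le_trans _ _ 1); first by rewrite expR_le1 oppr_le0.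
  rewrite -[leLHS]add0r lerD//; first by rewrite mulr_ge0 ?expR_ge0//; lra.
  by rewrite expr2; nra.
have -> : - r = - m + v by rewrite /v; ring.
have v1 : 0 < 1 - v by lra.
have ev : expR v <= 1 + v + 2 * v ^+ 2.
  apply: (@le_trans _ _ (1 - v)^-1).
    by rewrite -[expR v]invrK -expRN lef_pV2 ?posrE ?expR_gt0// expR_ge1Dx.
  by rewrite -div1r ler_pdivrMr//; nra.
rewrite expRD (le_trans (ler_wpM2l (expR_ge0 _) ev))// mulrDr lerD2l mulrA ler_wpM2r ?sqr_ge0//.
have : expR (- m) <= 1 by rewrite expR_le1 oppr_le0.
by move=> h; lra.
Qed.

(** Second order counterpart of the Jensen bound: the error is controlled by the
    variance, and 1 / (1 + c) = 1 - c / (1 + c) <= exp(- c / (1 + c)). *)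
Lemma renewal_gf_le_exp n c M : 0 <= c -> M = c / (1 + c) * negbin n (a + 1) ->
  renewal_gf n c <= expR (- M) +
    4 * ((c / (1 + c)) ^+ 2 * (2 * negbin n (a * 2 + 1)) - M ^+ 2).
Proof.
move=> c0; set v := c / (1 + c) => ME.
have c1 : 0 < 1 + c by rewrite ltr_pwDl.
have v0 : 0 <= v by rewrite divr_ge0// ltW.
have M0 : 0 <= M.
  rewrite ME mulr_ge0// -renewal_mean_succ -[leLHS](renewal_mean_cst n 0).
  by apply: le_renewal_mean => k.
have w : (1 + c)^-1 = 1 - v by rewrite /v; field; rewrite gt_eqF.
(* expRN_le_quadratic at r = v (k + 1) and m = M, expanded in powers of k + 1 *)
pose quad k : R := expR (- M) * (1 + M) + - (expR (- M) * v) * k.+1%:R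
  + (4 * v ^+ 2 * k.+1%:R ^+ 2 + (- (8 * M * v) * k.+1%:R + 4 * M ^+ 2)).
apply: (@le_trans _ _ (renewal_mean n quad)).
  apply: le_renewal_mean => k.
  apply: (@le_trans _ _ (expR (- (v * k.+1%:R)))).
    rewrite -mulNr expRM_natr lerXn2r ?nnegrE ?expR_ge0 ?invr_ge0 ?(ltW c1)//.
    by rewrite w expR_ge1Dx.
  have vk : 0 <= v * k.+1%:R by rewrite mulr_ge0.
  apply: (le_trans (@expRN_le_quadratic _ M vk M0)).
  by rewrite le_eqVlt; apply/orP; left; apply/eqP; rewrite /quad; ring.
rewrite !renewal_meanD !renewal_meanZ !renewal_mean_cst !renewal_mean_succ.
have := renewal_mean_succ_sqr_le n.
set S := renewal_mean n _; set T := negbin n (a * 2 + 1).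
move=> ST.
have : 0 <= 4 * v ^+ 2 * (2 * T - S).
  by apply: mulr_ge0; rewrite ?subr_ge0// mulr_ge0// sqr_ge0.
move=> D0; rewrite -subr_ge0; apply: (le_trans D0).
rewrite le_eqVlt; apply/orP; left; apply/eqP; rewrite ME; ring.
Qed.

(** The Taylor sums in c of (1 + c)^-(k+1) lie alternately above and below it.
    Multiplying by 1 + c lowers k and, by Pascal's rule, leaves one term of the
    right sign. *)
Lemma binomial_neg_alternating c k M : 0 <= c ->
  0 <= (-1) ^+ M * ((1 + c)^-1 ^+ k.+1 - \sum_(m < M) (- c) ^+ m * 'C(k + m, m)%:R).
Proof.
move=> c0; have c1 : 0 < 1 + c by rewrite ltr_pwDl.
have w0 : 0 <= (1 + c)^-1 by rewrite invr_ge0 ltW.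
case: M => [|M]; first by rewrite expr0 mul1r big_ord0 subr0 exprn_ge0.
elim: k => [|k IH].
  rewrite expr1 (eq_bigr (fun m : 'I__ => (- c) ^+ m)); last first.
    by move=> m _; rewrite add0n binn mulr1.
  have -> : (1 + c)^-1 - \sum_(m < M.+1) (- c) ^+ m = (- c) ^+ M.+1 * (1 + c)^-1.
    have := subrX1 (- c) M.+1; set S := \sum_(m < _) _ => h.
    have h' : (- c) ^+ M.+1 = 1 - (1 + c) * S.
      by rewrite -[LHS](subrK 1) h; ring.
    by rewrite h'; field; rewrite gt_eqF.
  by rewrite mulrA -exprMn mulrNN mul1r mulr_ge0 ?exprn_ge0.
rewrite -(pmulr_rge0 _ c1) mulrCA.
set S1 := \sum_(m < M.+1) _; set S0 := \sum_(m < M.+1) _ in IH.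
have S1E : (1 + c) * S1 = S0 - (- c) ^+ M.+1 * 'C(k.+1 + M, M)%:R.
  rewrite /S1 /S0; elim: M {IH S1 S0} => [|M IHM].
    by rewrite !big_ord1 !addn0 !bin0 expr0 expr1; ring.
  rewrite big_ord_recr /= mulrDr IHM [in RHS]big_ord_recr /=.
  rewrite (_ : (k.+1 + M.+1 = (k + M.+1).+1)%N)// binS natrD !exprS.
  rewrite [(k.+1 + M)%N]addSnnS; ring.
rewrite mulrBr S1E [(1 + c)^-1 ^+ _]exprS mulrA divff ?gt_eqF// mul1r opprB addrCA mulrDr addr_ge0//.
by rewrite mulrA -exprMn mulrNN mul1r mulr_ge0 ?exprn_ge0.
Qed.

(** Two consecutive alternating bounds enclose the remainder by the first omitted
    term; no convergence of the expansion is needed. *)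
Lemma renewal_gf_approx n c M : 0 <= c ->
  `|renewal_gf n c - \sum_(m < M) (- c) ^+ m * negbin n (a * m%:R + 1)|
    <= c ^+ M * negbin n (a * M%:R + 1).
Proof.
move=> c0.
pose rem K k : R := (1 + c)^-1 ^+ k.+1 - \sum_(m < K) (- c) ^+ m * 'C(k + m, m)%:R.
have remE K : renewal_gf n c - \sum_(m < K) (- c) ^+ m * negbin n (a * m%:R + 1) =
    renewal_mean n (rem K).
  rewrite /renewal_gf -[X in _ - X](_ : renewal_mean n (fun k => \sum_(m < K)
      (- c) ^+ m * 'C(k + m, m)%:R) = _); last first.
    rewrite (@renewal_mean_sum n K (fun m k => (- c) ^+ m * 'C(k + m, m)%:R)).
    apply: eq_bigr => m _.
    by rewrite renewal_meanZ renewal_moment.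
  rewrite -mulN1r -renewal_meanZ -renewal_meanD; apply: eq_renewal_mean => k.
  by rewrite mulN1r.
have s0 K : 0 <= (-1) ^+ K * renewal_mean n (rem K).
  rewrite -renewal_meanZ -[leLHS](renewal_mean_cst n 0).
  by apply: le_renewal_mean => k; exact: binomial_neg_alternating.
rewrite remE -(normrMsign M) ger0_norm//.
rewrite -renewal_moment -!renewal_meanZ; apply: le_renewal_mean => k.
have := @binomial_neg_alternating c k M.+1 c0.
rewrite big_ord_recr /= opprD addrA mulrBr exprS -/(rem M k) => h.
rewrite -subr_ge0; apply: (le_trans h); rewrite le_eqVlt; apply/orP; left; apply/eqP.
have -> : (- c) ^+ M = (-1) ^+ M * c ^+ M by rewrite -exprMn mulN1r.
have : (-1) ^+ M * (-1) ^+ M = 1 :> R by rewrite -exprMn mulrNN mul1r expr1n.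
set e := (-1) ^+ M; move=> e2.
transitivity (e * e * (c ^+ M * 'C(k + M, M)%:R) - e * rem M k); first by ring.
by rewrite e2 mul1r.
Qed.
End renewal.

(** * Gauss's product formula and the Mittag-Leffler function *)

Section mittag_leffler.
Context {R : realType}.
Implicit Types (s t c x a : R) (n k m M : nat).

Lemma Gamma_addn x n : 0 < x -> Gamma (x + n%:R) = negbin n x * n`!%:R * Gamma x.
Proof.
move=> x0; elim: n => [|n IH]; first by rewrite negbin0 fact0 addr0 !mul1r.
rewrite -natr1 addrA Gamma_rec ?ltr_wpDr// IH factS natrM.
rewrite (_ : negbin n.+1 x * _ * _ = (negbin n.+1 x * n.+1%:R) * n`!%:R * Gamma x).
  by rewrite negbinS; ring.
by ring.
Qed.

Lemma Gamma_fact n : Gamma n.+1%:R = n`!%:R :> R.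
Proof. by rewrite -nat1r Gamma_addn// negbinN1 Gamma1 mul1r mulr1. Qed.

Lemma negbin_shift n s : negbin n (s + 1) * s = negbin n s * (s + n%:R).
Proof.
elim: n => [|n IH]; first by rewrite !negbin0 addr0.
apply: (mulIf (_ : n.+1%:R != 0)); first by rewrite pnatr_eq0.
rewrite [LHS]mulrAC negbinS [LHS]mulrAC IH [RHS]mulrAC negbinS -natr1; ring.
Qed.

Lemma cvgn_eq (f g : nat -> R) (p q : R) :
  g n @[n --> \oo] --> q -> f =1 g -> p = q -> f n @[n --> \oo] --> p.
Proof. by move=> h /funext -> ->. Qed.

Lemma cvg_invn : (n.+1%:R^-1 : R) @[n --> \oo] --> (0 : R).
Proof. exact: cvg_harmonic. Qed.

Lemma cvg_ratio_addn s : ((s + n.+1%:R) / n.+1%:R) @[n --> \oo] --> (1 : R).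
Proof.
have h : (1 + s * n.+1%:R^-1 : R) @[n --> \oo] --> (1 + s * 0 : R).
  by apply: cvgD; [exact: cvg_cst|apply: cvgM; [exact: cvg_cst|exact: cvg_invn]].
rewrite mulr0 addr0 in h; apply: cvg_trans h; apply: near_eq_cvg; near=> n.
by rewrite mulrDl divff ?pnatr_eq0// addrC.
Unshelve. all: by end_near. Qed.

(** Wendel's inequality at n + 2 with s and at n + 2 + s with 1 - s squeezes the
    ratio Gamma(n + 2 + s) / ((n + 1)! (n + 1)^s) between (n + 2) / (n + 3) and
    (n + 2) / (n + 1). *)
Lemma negbin_cvg_unit s : 0 <= s <= 1 ->
  negbin n.+1 (s + 1) / n.+1%:R `^ s @[n --> \oo] --> (Gamma (s + 1))^-1.
Proof.
move=> s01; have /andP[s0 s1] := s01.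
have s10 : 0 < s + 1 by rewrite ltr_wpDl.
have G0 := Gamma_gt0 s10.
have E n : negbin n.+1 (s + 1) = Gamma (n.+2%:R + s) / n.+1`!%:R / Gamma (s + 1).
  rewrite (_ : n.+2%:R + s = s + 1 + n.+1%:R); last by rewrite -[n.+2%:R]natr1; ring.
  rewrite Gamma_addn// ; field; rewrite (gt_eqF G0) /= pnatr_eq0 -lt0n fact_gt0//.
rewrite -[X in _ --> X]mul1r.
pose rho n : R := Gamma (n.+2%:R + s) / n.+1`!%:R / n.+1%:R `^ s.
apply: (@cvg_trans _ (rho n * (Gamma (s + 1))^-1 @[n --> \oo])).
  by apply: near_eq_cvg; near=> n; rewrite E /rho mulrAC.
apply: cvgM; last exact: cvg_cst.
have up : (1 + n.+1%:R) / n.+1%:R @[n --> \oo] --> (1 : R) by exact: cvg_ratio_addn.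
have lo : ((1 + n.+2%:R) / n.+2%:R)^-1 @[n --> \oo] --> (1 : R).
  rewrite -[X in _ --> X]invr1; apply: cvgV; first exact: (oner_neq0 R).
  have := @cvg_ratio_addn 1.
  by rewrite -(cvg_shiftS (fun n => (1 + n.+1%:R) / n.+1%:R : R)).
apply: (squeeze_cvgr _ lo up); near=> n.
have n0 : 0 < n.+1%:R :> R by [].
have f0 : 0 < n.+1`!%:R :> R by rewrite ltr0n fact_gt0.
have p0 : 0 < n.+1%:R `^ s :> R by rewrite powR_gt0.
have ns0 : 0 < n.+2%:R + s by rewrite ltr_pwDl.
apply/andP; split.
  have := @Wendel R (n.+2%:R + s) (1 - s) ns0.
  rewrite subr_ge0 s1 gerBl s0 => /(_ isT).
  rewrite (_ : n.+2%:R + s + (1 - s) = n.+3%:R); last by rewrite -[in RHS]natr1; ring.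
  rewrite Gamma_fact factS natrM => W.
  have q0 : 0 < 1 + n.+2%:R :> R by rewrite ltr_pwDl.
  have h : (n.+2%:R + s) `^ (1 - s) * n.+1%:R `^ s <= 1 + n.+2%:R.
    apply: (@le_trans _ _ ((1 + n.+2%:R) `^ (1 - s) * (1 + n.+2%:R) `^ s)).
      apply: ler_pM; rewrite ?powR_ge0//.
        by rewrite ge0_ler_powR ?nnegrE ?subr_ge0 ?(ltW ns0) ?(ltW q0)//; lra.
      by rewrite ge0_ler_powR ?nnegrE ?(ltW q0)// -[n.+2%:R]natr1; lra.
    by rewrite -powRD ?subrK ?powRr1 ?(ltW q0)// gt_eqF ?implybT.
  rewrite /rho invf_div ler_pdivlMr// ler_pdivlMr//.
  rewrite -mulrA mulrAC ler_pdivrMr ?ltr_pwDl// (mulrC (n.+1%:R `^ s)) mulrA.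
  apply: le_trans (ler_wpM2r (ltW p0) W) _.
  by rewrite mulrAC mulrC ler_wpM2l// ltW// Gamma_gt0.
have := @Wendel R n.+2%:R s (ltr0Sn _ _) s01.
rewrite Gamma_fact => W.
rewrite /rho ler_pdivrMr// ler_pdivrMr// (le_trans W)// ler_wpM2r ?(ltW f0)//.
rewrite -[X in X `^ s <= _](divfK (lt0r_neq0 n0)) powRM ?(ltW n0) ?divr_ge0//.
rewrite ler_wpM2r ?powR_ge0// nat1r ler1_powR//.
by rewrite ler_pdivlMr// mul1r ler_nat.
Unshelve. all: by end_near. Qed.

(** Gauss's product formula for Gamma(s + 1). *)
Definition gauss_cvg s :=
  negbin n.+1 (s + 1) / n.+1%:R `^ s @[n --> \oo] --> (Gamma (s + 1))^-1.

Lemma gauss_cvg_succ s : -1 < s -> gauss_cvg (s + 1) <-> gauss_cvg s.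
Proof.
move=> s1; have s0 : 0 < s + 1 by lra.
have s0' := lt0r_neq0 s0.
have p0 n : n.+1%:R `^ s != 0 :> R by rewrite powR_eq0 pnatr_eq0.
have pS n : n.+1%:R `^ (s + 1) = n.+1%:R `^ s * n.+1%:R :> R.
  by rewrite powRD ?powRr1// pnatr_eq0 implybT.
have E n : negbin n.+1 (s + 1 + 1) / n.+1%:R `^ (s + 1) =
    negbin n.+1 (s + 1) / n.+1%:R `^ s * ((s + 1 + n.+1%:R) / n.+1%:R) * (s + 1)^-1.
  apply: (mulIf s0'); rewrite mulrAC negbin_shift pS; field.
  by rewrite p0 s0' nat1r pnatr_eq0.
have r1 := cvg_ratio_addn (s + 1).
have n0 n : s + 1 + n.+1%:R != 0 by rewrite gt_eqF// addr_gt0.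
rewrite /gauss_cvg; split=> h.
  have h1 : ((s + 1 + n.+1%:R) / n.+1%:R)^-1 @[n --> \oo] --> (1^-1 : R).
    by apply: cvgV => //; exact: oner_neq0.
  apply: (cvgn_eq (cvgM (cvgM h (cvg_cst (s + 1))) h1)).
    by move=> n; rewrite /= E; field; rewrite nat1r n0 p0 s0' pnatr_eq0.
  by rewrite (Gamma_rec s0) divr1 invfM mulrAC mulVf// mul1r.
apply: (cvgn_eq (cvgM (cvgM h r1) (cvg_cst (s + 1)^-1))).
  by move=> n; rewrite /= E.
by rewrite (Gamma_rec s0) invfM mulr1 mulrC.
Qed.

Lemma negbin_cvg s : -1 < s -> gauss_cvg s.
Proof.
have pos : forall t, 0 <= t -> gauss_cvg t.
  move=> t t0; have [n nt] : exists n, t <= n%:R.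
    by exists (Num.bound t); exact/ltW/archi_boundP.
  elim: n t t0 nt => [|n IH] t t0 nt.
    by apply: negbin_cvg_unit; rewrite t0 (le_trans nt).
  have [t1|t1] := leP t 1; first by apply: negbin_cvg_unit; rewrite t0.
  rewrite -(subrK 1 t); apply/gauss_cvg_succ; first by lra.
  by apply: IH; rewrite ?lerBlDr ?natr1//; lra.
move=> s1; have [s0|s0] := leP 0 s; first exact: pos.
by apply: (gauss_cvg_succ s1).1; apply: pos; lra.
Qed.

Section order.
Variable a : R.
Hypothesis a01 : 0 < a < 1.
Let a0 : 0 < a. Proof. by have /andP[] := a01. Qed.
Let a1 : a < 1. Proof. by have /andP[] := a01. Qed.

(** The argument of the generating function for which the number of renewals up
    to time n + 1 is seen on the scale (n + 1)^a. *)
Definition mesh x n : R := x / n.+1%:R `^ a.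

Lemma mesh_cvg0 x : mesh x n @[n --> \oo] --> (0 : R).
Proof.
rewrite -[0](mulr0 x); apply: cvgM; first exact: cvg_cst.
have h : (n.+1%:R^-1 : R) `^ a @[n --> \oo] --> (0 : R).
  by have /cvg_at_rightP h := powR_cvg0 a0; apply: h; split => //; exact: cvg_invn.
apply: cvg_trans h; apply: near_eq_cvg; near=> n.
by rewrite /= -powR_inv1// -!powRrM mulN1r powRN.
Unshelve. all: by end_near. Qed.

Lemma mesh_ge0 x n : 0 <= x -> 0 <= mesh x n.
Proof. by move=> x0; rewrite divr_ge0 ?powR_ge0. Qed.

Lemma mesh_negbin_cvg x m :
  mesh x n ^+ m * negbin n.+1 (a * m%:R + 1) @[n --> \oo]
    --> x ^+ m / Gamma (a * m%:R + 1).
Proof.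
have h : x ^+ m * (negbin n.+1 (a * m%:R + 1) / n.+1%:R `^ (a * m%:R))
    @[n --> \oo] --> x ^+ m / Gamma (a * m%:R + 1).
  apply: cvgM; first exact: cvg_cst.
  by apply: negbin_cvg; rewrite (lt_le_trans (ltrN10 _))// mulr_ge0// ltW.
apply: cvg_trans h; apply: near_eq_cvg; near=> n.
rewrite /= powRrM powR_mulrn ?powR_ge0// /mesh exprMn exprVn; ring.
Unshelve. all: by end_near. Qed.

Lemma mittag_leffler_term_le x : 0 <= x ->
  exists2 C, 0 < C & forall m, x ^+ m / Gamma (a * m%:R + 1) <= C * 2^-1 ^+ m.
Proof.
move=> x0; (* chosen so that K^a exceeds 2 x and the terms decay at least like 2^-m *)
set K := (2 * x + 1) `^ a^-1.
have y0 : 0 < 2 * x + 1 by lra.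
exists (expR K) => [|m]; first exact: expR_gt0.
have am0 : 0 <= a * m%:R by rewrite mulr_ge0// ltW.
have G0 : 0 < Gamma (a * m%:R + 1) by rewrite Gamma_gt0// ltr_wpDl.
have := @Gamma_ge_powR R K (a * m%:R) (powR_ge0 _ _) am0.
rewrite powRrM /K -[X in X `^ m%:R]powRrM mulVf ?gt_eqF// powRr1 ?(ltW y0)// powR_mulrn ?(ltW y0)//.
rewrite expRN ler_pdivrMr ?expR_gt0// => h.
rewrite ler_pdivrMr// mulrAC mulrC.
apply: (@le_trans _ _ (2^-1 ^+ m * (2 * x + 1) ^+ m)).
  by rewrite -exprMn lerXn2r ?nnegrE//; [rewrite mulr_ge0 ?ltW|lra].
by rewrite ler_wpM2l ?exprn_ge0// [leRHS]mulrC.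
Qed.

Lemma mittag_leffler_cvg x : 0 <= x ->
  series (fun k => (- x) ^+ k / Gamma (a * k%:R + 1)) n @[n --> \oo]
    --> mittag_leffler a 1 (- x).
Proof.
move=> x0; have [C C0 hC] := mittag_leffler_term_le x0.
have : cvgn (series (fun k => (- x) ^+ k / Gamma (a * k%:R + 1))).
  apply: normed_cvg; apply: (@series_le_cvg _ _ (geometric C 2^-1)).
  - by move=> n; rewrite /=.
  - by move=> n; rewrite geometric_ge0// ltW.
  - move=> n /=; rewrite normrM normrX normrN (ger0_norm x0) normfV.
    rewrite (@ger0_norm _ (Gamma _)) ?hC// ltW// Gamma_gt0// ltr_wpDl//.
    by rewrite mulr_ge0// ltW.
  by apply: is_cvg_geometric_series; rewrite ger0_norm// invf_lt1// ltr1n.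
by [].
Qed.

(** The two limits in play, of the generating function and of the partial sums,
    are separated: for a fixed M the first M terms converge, and the first
    omitted term bounds the error uniformly in n. *)
Lemma mittag_leffler_approx x M : 0 <= x -> exists2 e : nat -> R,
  e n @[n --> \oo] --> x ^+ M / Gamma (a * M%:R + 1) &
  exists2 S : nat -> R,
  S n @[n --> \oo] --> series (fun k => (- x) ^+ k / Gamma (a * k%:R + 1)) M &
  forall n, `|renewal_gf a n.+1 (mesh x n) - S n| <= e n.
Proof.
move=> x0.
exists (fun n => mesh x n ^+ M * negbin n.+1 (a * M%:R + 1)).
  exact: mesh_negbin_cvg.
exists (fun n => \sum_(m < M) (- mesh x n) ^+ m * negbin n.+1 (a * m%:R + 1)).
  rewrite seriesEord /=; elim: M => [|M IH].
    apply: (cvgn_eq (cvg_cst (0 : R))) => [n|]; last by rewrite big_ord0.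
    by rewrite /= big_ord0.
  have hM := @mesh_negbin_cvg (- x) M.
  apply: cvgn_eq; first by apply: cvgD; [exact: IH|exact: hM].
    by move=> n; rewrite /= big_ord_recr /= /mesh mulNr.
  by rewrite big_ord_recr.
by move=> n; apply: renewal_gf_approx => //; exact: mesh_ge0.
Qed.

Lemma mittag_leffler_rem_cvg0 x : 0 <= x ->
  x ^+ M / Gamma (a * M%:R + 1) @[M --> \oo] --> (0 : R).
Proof.
move=> x0; have [C C0 hC] := mittag_leffler_term_le x0.
have h : geometric C 2^-1 n @[n --> \oo] --> (0 : R).
  by apply: cvg_geometric; rewrite ger0_norm// invf_lt1// ltr1n.
apply: (squeeze_cvgr _ (cvg_cst 0) h); near=> n.
rewrite hC andbT divr_ge0 ?exprn_ge0// ltW// Gamma_gt0// ltr_wpDl//.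
by rewrite mulr_ge0// ltW.
Unshelve. all: by end_near. Qed.

(** First n tends to infinity with M fixed, then M; the first omitted term of the
    series disappears in the second limit. *)
Lemma mittag_leffler_ge (v : nat -> R) (l : R) x : 0 <= x ->
  v n @[n --> \oo] --> l -> (forall n, v n <= renewal_gf a n.+1 (mesh x n)) ->
  l <= mittag_leffler a 1 (- x).
Proof.
move=> x0 vl hv.
have H : (series (fun k => (- x) ^+ k / Gamma (a * k%:R + 1)) n
    + x ^+ n / Gamma (a * n%:R + 1)) @[n --> \oo] --> mittag_leffler a 1 (- x).
  rewrite -[X in _ --> X]addr0; apply: cvgD (mittag_leffler_rem_cvg0 x0).
  exact: mittag_leffler_cvg.
 apply: (ler_cvg_to (cvg_cst l) H); near=> M.
have [e he [S hS hb]] := mittag_leffler_approx M x0.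
apply: (ler_cvg_to vl (cvgD hS he)); near=> n.
by have := hb n; rewrite ler_distl => /andP[_]; apply: le_trans; exact: hv.
Unshelve. all: by end_near. Qed.

Lemma mittag_leffler_le (v : nat -> R) (l : R) x : 0 <= x ->
  v n @[n --> \oo] --> l -> (forall n, renewal_gf a n.+1 (mesh x n) <= v n) ->
  mittag_leffler a 1 (- x) <= l.
Proof.
move=> x0 vl hv.
have H : (series (fun k => (- x) ^+ k / Gamma (a * k%:R + 1)) n
    - x ^+ n / Gamma (a * n%:R + 1)) @[n --> \oo] --> mittag_leffler a 1 (- x).
  rewrite -[X in _ --> X]subr0; apply: cvgB (mittag_leffler_rem_cvg0 x0).
  exact: mittag_leffler_cvg.
 apply: (ler_cvg_to H (cvg_cst l)); near=> M.
have [e he [S hS hb]] := mittag_leffler_approx M x0.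
apply: (ler_cvg_to (cvgB hS he) vl); near=> n.
by have := hb n; rewrite ler_distl => /andP[h _]; exact: le_trans h (hv n).
Unshelve. all: by end_near. Qed.

Lemma mittag_leffler_ge_exp x : 0 <= x ->
  expR (- (x / Gamma (a + 1))) <= mittag_leffler a 1 (- x).
Proof.
move=> x0.
apply: (@mittag_leffler_ge (fun n => expR (- (mesh x n * negbin n.+1 (a + 1))))) => //.
  have h := @mesh_negbin_cvg x 1; rewrite mulr1 expr1 in h.
  apply: (cvg_comp (fun n => - (mesh x n * negbin n.+1 (a + 1))) expR).
    exact: cvgN h.
  exact: continuous_expR.
by move=> n; apply: renewal_gf_ge_exp => //; exact: mesh_ge0.
Qed.

(** This is survival / (survival + c) in the limit, since survival n behaves like
    n^-a / Gamma(1 - a). *)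
Lemma mittag_leffler_ge_rational x : 0 <= x ->
  (1 + Gamma (1 - a) * x)^-1 <= mittag_leffler a 1 (- x).
Proof.
move=> x0.
have G0 : 0 < Gamma (1 - a) by rewrite Gamma_gt0 ?subr_gt0.
pose q n : R := negbin n.+1 (- a + 1) / n.+1%:R `^ (- a).
have hq : q n @[n --> \oo] --> (Gamma (1 - a))^-1.
  by rewrite (addrC 1); apply: negbin_cvg; rewrite ltrNl opprK.
have hG : 0 < (Gamma (1 - a))^-1 + x by rewrite ltr_pwDl ?invr_gt0.
have -> : (1 + Gamma (1 - a) * x)^-1 = (Gamma (1 - a))^-1 / ((Gamma (1 - a))^-1 + x).
  have d0 : 0 < 1 + Gamma (1 - a) * x by rewrite ltr_pwDl// mulr_ge0// ltW.
  by field; rewrite !gt_eqF// mulrC.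
apply: (@mittag_leffler_ge (fun n => q n / (q n + x))) => //.
  apply: cvgM => //; apply: cvgV; first by rewrite gt_eqF.
  by apply: cvgD => //; exact: cvg_cst.
move=> n; apply: le_trans (renewal_gf_ge_survival a01 n.+1 (mesh_ge0 n x0)).
have p0 : 0 < n.+1%:R `^ a :> R by rewrite powR_gt0.
have s0 := survival_gt0 a01 n.+1.
rewrite le_eqVlt; apply/orP; left; apply/eqP.
rewrite /q /mesh powRN invrK (addrC _ 1) -/(survival a n.+1).
have d0 : 0 < survival a n.+1 * n.+1%:R `^ a + x by rewrite ltr_pwDl ?mulr_gt0.
by field; rewrite !gt_eqF.
Qed.

(** The last summand is 4 x^2 times the variance of the limit law: the first and
    second moments of the discrete law converge to those of the limit. *)
Lemma mittag_leffler_le_exp x : 0 <= x ->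
  mittag_leffler a 1 (- x) <= expR (- (x / Gamma (a + 1))) +
    4 * (x ^+ 2 * (2 / Gamma (a * 2 + 1)) - (x / Gamma (a + 1)) ^+ 2).
Proof.
move=> x0.
pose M n := mesh x n / (1 + mesh x n) * negbin n.+1 (a + 1).
pose Q n := (mesh x n / (1 + mesh x n)) ^+ 2 * (2 * negbin n.+1 (a * 2 + 1)).
have h1 : (1 + mesh x n)^-1 @[n --> \oo] --> (1 : R).
  rewrite -[X in _ --> X]invr1; apply: cvgV; first exact: (oner_neq0 R).
  by rewrite -[X in _ --> X]addr0; apply: cvgD (mesh_cvg0 x); exact: cvg_cst.
have hM : M n @[n --> \oo] --> x / Gamma (a + 1).
  have h := @mesh_negbin_cvg x 1; rewrite mulr1 expr1 in h.
  apply: (cvgn_eq (cvgM h h1)); last by rewrite mulr1.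
  by move=> n; rewrite /M /=; ring.
have hQ : Q n @[n --> \oo] --> x ^+ 2 * (2 / Gamma (a * 2 + 1)).
  have h := @mesh_negbin_cvg x 2.
  apply: cvgn_eq; first by apply: cvgM (cvgM (cvg_cst (2 : R)) h) (cvgM h1 h1).
    by move=> n; rewrite /Q /=; ring.
  by rewrite !mulr1 mulrCA.
apply: (@mittag_leffler_le (fun n => expR (- M n) + 4 * (Q n - M n ^+ 2))) => //.
  apply: cvgD.
    apply: (cvg_comp (fun n => - M n) expR); first exact: cvgN hM.
    exact: continuous_expR.
  apply: cvgM; first exact: cvg_cst.
  by apply: cvgB => //; rewrite expr2; apply: cvgM.
by move=> n; apply: renewal_gf_le_exp => //; exact: mesh_ge0.
Unshelve. all: by end_near. Qed.

End order.
End mittag_leffler.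

(** * The ratio exp(-m y) / E_{a,1}(-m y^a) for a near 1 *)

Section ratio.
Context {R : realType}.
Implicit Types (a m y L x : R).

(** Wendel's inequality on [1, 2] from both ends, using Gamma(1) = Gamma(2) = 1. *)
Lemma invGamma_bounds a : 0 < a < 1 -> 1 <= (Gamma (a + 1))^-1 <= 2 - a.
Proof.
move=> /andP[a0 a1]; have G0 : 0 < Gamma (a + 1) by rewrite Gamma_gt0 ?addr_gt0.
apply/andP; split.
  rewrite -[leLHS]invr1 lef_pV2 ?posrE//.
  have := @Wendel R 1 a ltr01; rewrite powR1 Gamma1 mulr1 addrC; apply.
  by rewrite !ltW.
have b01 : 0 <= 1 - a <= 1 by rewrite subr_ge0 gerBl !ltW.
have := Wendel (addr_gt0 a0 ltr01) b01.
rewrite (_ : a + 1 + (1 - a) = 1 + 1); last by ring.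
rewrite (Gamma_rec ltr01) Gamma1 mulr1 -ler_pdivrMr// div1r => /le_trans; apply.
apply: (le_trans (powR_le_tangent b01 (addr_gt0 a0 ltr01))); nra.
Qed.

Lemma Gamma_onem_le a : 0 < a < 1 -> Gamma (1 - a) <= (1 - a)^-1.
Proof.
move=> /andP[a0 a1]; have b0 : 0 < 1 - a by rewrite subr_gt0.
rewrite -[leRHS]mul1r ler_pdivlMr// mulrC -Gamma_rec//.
have := @Wendel R 1 (1 - a) ltr01.
rewrite powR1 Gamma1 mulr1 (addrC 1 (1 - a)); apply.
by rewrite subr_ge0 gerBl !ltW.
Qed.

(** Gamma(2 a + 1) is compared with Gamma(3) = 2. *)
Lemma invGamma_double_le a : 2^-1 <= a < 1 ->
  2 / Gamma (a * 2 + 1) <= 1 + 4 * (1 - a).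
Proof.
move=> /andP[a0 a1].
have x0 : 0 < a * 2 + 1 by lra.
have G0 : 0 < Gamma (a * 2 + 1) by rewrite Gamma_gt0.
have b01 : 0 <= 2 - a * 2 <= 1 by apply/andP; split; lra.
have := @Wendel R (a * 2 + 1) (2 - a * 2) x0 b01.
rewrite (_ : a * 2 + 1 + (2 - a * 2) = 1 + 1 + 1); last by ring.
rewrite (Gamma_rec (addr_gt0 ltr01 ltr01)) (Gamma_rec ltr01) Gamma1 !mulr1 -ler_pdivrMr// => /le_trans; apply.
apply: (le_trans (powR_le_tangent b01 x0)); nra.
Qed.

Notation ml a x := (mittag_leffler a 1 (- x)).

Lemma ml_gt0 a x : 0 < a < 1 -> 0 <= x -> 0 < ml a x.
Proof. by move=> a01 x0; apply: lt_le_trans (mittag_leffler_ge_exp a01 x0); exact: expR_gt0. Qed.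

Lemma powR_le_add a y : 0 < a < 1 -> 0 < y -> y `^ a <= y + (1 - a).
Proof.
move=> /andP[a0 a1] y0.
apply: (le_trans (@powR_le_tangent _ a y _ y0)); first by rewrite !ltW.
nra.
Qed.

(** Write y = y^a y^(1-a) and bound the second factor by its tangent at 1. *)
Lemma powR_ge_sub a y : 0 < a < 1 -> 0 < y -> y - (1 - a) * y ^+ 2 <= y `^ a.
Proof.
move=> /andP[a0 a1] y0.
have h : y `^ (1 - a) <= 1 + (1 - a) * y.
  apply: (le_trans (@powR_le_tangent _ (1 - a) y _ y0)).
    by rewrite subr_ge0 gerBl !ltW.
  lra.
have p0 : 0 < y `^ a by rewrite powR_gt0.
have yE : y = y `^ a * y `^ (1 - a).
  by rewrite -powRD ?subrKC ?powRr1 ?ltW// gt_eqF ?implybT.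
have h2 : y <= y `^ a * (1 + (1 - a) * y) by rewrite {1}yE ler_pM2l.
have d0 : 0 < 1 + (1 - a) * y by nra.
rewrite -(ler_pM2r d0); apply: le_trans h2.
have : 0 <= (1 - a) ^+ 2 * y ^+ 3.
  by apply: mulr_ge0; [exact: sqr_ge0|apply: exprn_ge0; exact: ltW].
rewrite !exprS expr0; nra.
Qed.

(** The Jensen bound, where both 1 / Gamma(a + 1) - 1 and y^a - y are at most
    1 - a. *)
Lemma ml_ratio_le a m y L : 0 < a < 1 -> 0 <= m -> 0 < y < L ->
  expR (- (m * y)) / ml a (m * y `^ a) <= expR (m * (1 - a) * (L + 2)).
Proof.
move=> a01 m0 /andP[y0 yL]; have x0 : 0 <= m * y `^ a by rewrite mulr_ge0 ?powR_ge0.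
have /andP[a0 a1] := a01.
rewrite ler_pdivrMr ?ml_gt0//.
apply: le_trans (ler_wpM2l (expR_ge0 _) (mittag_leffler_ge_exp a01 x0)).
rewrite -expRD ler_expR.
have /andP[_ G2] := invGamma_bounds a01.
have ya := powR_le_add a01 y0.
have : m * y `^ a / Gamma (a + 1) <= m * (y + (1 - a)) * (2 - a).
  apply: ler_pM => //; first by rewrite invr_ge0 ltW// Gamma_gt0 ?addr_gt0.
  by rewrite ler_wpM2l.
have : 0 <= m * ((1 - a) * (L - y + a)).
  by rewrite mulr_ge0// mulr_ge0//; lra.
lra.
Qed.

(** The second order bound, where the variance is at most 4 (1 - a). *)
Lemma ml_ratio_ge a m y L : 2^-1 <= a < 1 -> 0 <= m -> 0 < y < L ->
  (expR (m * (1 - a) * L ^+ 2) +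
    16 * (m ^+ 2 * (L + 1) ^+ 2 * (1 - a)) * expR (m * L))^-1
  <= expR (- (m * y)) / ml a (m * y `^ a).
Proof.
move=> ha m0 /andP[y0 yL]; have x0 : 0 <= m * y `^ a by rewrite mulr_ge0 ?powR_ge0.
have /andP[a2 a1] := ha.
have a01 : 0 < a < 1 by rewrite a1 andbT; lra.
have /andP[a0 _] := a01.
have L0 : 0 < L by exact: lt_trans yL.
have T0 : 0 <= 16 * (m ^+ 2 * (L + 1) ^+ 2 * (1 - a)).
  apply: mulr_ge0 => //; apply: mulr_ge0; last by lra.
  by apply: mulr_ge0; exact: sqr_ge0.
rewrite -[leRHS]invrK lef_pV2 ?posrE ?invr_gt0 ?divr_gt0 ?expR_gt0 ?ml_gt0//; last first.
  by rewrite ltr_pwDl ?expR_gt0// mulr_ge0 ?expR_ge0.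
rewrite invf_div ler_pdivrMr ?expR_gt0//.
apply: (le_trans (mittag_leffler_le_exp a01 x0)).
have /andP[G1 _] := invGamma_bounds a01.
have G3 := invGamma_double_le ha.
have ya := powR_le_add a01 y0.
have yb := powR_ge_sub a01 y0.
rewrite [leRHS]mulrDl; apply: lerD.
  rewrite -expRD ler_expR.
  have : m * y `^ a <= m * y `^ a / Gamma (a + 1) by rewrite ler_peMr.
  have : m * (y - (1 - a) * y ^+ 2) <= m * y `^ a by rewrite ler_wpM2l.
  have : m * (1 - a) * y ^+ 2 <= m * (1 - a) * L ^+ 2.
    by rewrite ler_wpM2l ?mulr_ge0 ?subr_ge0 ?(ltW a1)// lerXn2r ?nnegrE ?ltW.
  lra.
apply: (@le_trans _ _ (16 * (m ^+ 2 * (L + 1) ^+ 2 * (1 - a)))); last first.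
  rewrite -[leRHS]mulrA -expRD ler_peMr// -expR0 ler_expR -mulrBr mulr_ge0// subr_ge0 ltW//.
rewrite [leRHS](_ : _ = 4 * (4 * (m ^+ 2 * (L + 1) ^+ 2 * (1 - a)))); last by ring.
rewrite ler_wpM2l//.
have -> : (m * y `^ a / Gamma (a + 1)) ^+ 2 = (m * y `^ a) ^+ 2 * (Gamma (a + 1))^-1 ^+ 2.
  by rewrite -exprMn.
rewrite -mulrBr.
have G4 : 1 <= (Gamma (a + 1))^-1 ^+ 2 by rewrite exprn_ege1.
have X2 : (m * y `^ a) ^+ 2 <= m ^+ 2 * (L + 1) ^+ 2.
  rewrite exprMn ler_wpM2l ?sqr_ge0// lerXn2r ?nnegrE ?powR_ge0 ?addr_ge0 ?ltW//.
  apply: (le_lt_trans ya); lra.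
apply: (@le_trans _ _ ((m * y `^ a) ^+ 2 * (4 * (1 - a)))).
  by rewrite ler_wpM2l ?sqr_ge0//; lra.
rewrite mulrCA ler_wpM2l// ler_wpM2r// subr_ge0 ltW//.
Qed.

(** The two-sided bounds on the ratio tend to 1 and do not depend on y. *)
Lemma ml_ratio_cvg (T : Type) (F : set_system T) {FF : ProperFilter F}
    (al : T -> R) m L : 0 <= m ->
  al d @[d --> F] --> (1 : R) -> (\forall d \near F, 0 < al d < 1) ->
  forall e, 0 < e -> \forall d \near F, forall y, 0 < y < L ->
    `|expR (- (m * y)) / ml (al d) (m * y `^ al d) - 1| <= e.
Proof.
move=> m0 al1 al01 e e0.
have b0 : (1 - al d) @[d --> F] --> (0 : R).
  by rewrite -[0](subrr 1); apply: cvgB => //; exact: cvg_cst.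
pose hi d := expR (m * (1 - al d) * (L + 2)).
pose lo d := (expR (m * (1 - al d) * L ^+ 2) +
    16 * (m ^+ 2 * (L + 1) ^+ 2 * (1 - al d)) * expR (m * L))^-1.
have cst (c : R) : (fun=> c) d @[d --> F] --> c by exact: cvg_cst.
have exp_cvg (c : R) : expR (m * (1 - al d) * c) @[d --> F] --> (1 : R).
  have h : m * (1 - al d) * c @[d --> F] --> m * 0 * c by apply: cvgM => //; apply: cvgM.
  rewrite [X in _ --> X](_ : _ = expR (m * 0 * c)); last by rewrite mulr0 mul0r expR0.
  by apply: (cvg_comp (fun d => m * (1 - al d) * c) expR h); exact: continuous_expR.
have hi1 : hi d @[d --> F] --> (1 : R) by exact: exp_cvg.
have lo1 : lo d @[d --> F] --> (1 : R).
  rewrite -[X in _ --> X]invr1; apply: cvgV; first exact: oner_neq0.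
  rewrite [X in _ --> X](_ : _ = 1 + 16 * (m ^+ 2 * (L + 1) ^+ 2 * 0) * expR (m * L)); last first.
    by rewrite !mulr0 mul0r addr0.
  apply: cvgD; first exact: exp_cvg.
  by apply: cvgM => //; apply: cvgM => //; apply: cvgM.
near=> d => y y0L.
have a01 : 0 < al d < 1 by near: d.
have a2 : 2^-1 <= al d.
  near: d; apply: cvgr_ge al1 _ _; rewrite invf_lt1// ltr1n//.
have ha : 2^-1 <= al d < 1 by rewrite a2; case/andP: a01.
rewrite ler_distl; apply/andP; split.
  apply: le_trans (ml_ratio_ge ha m0 y0L).
  near: d; apply: cvgr_ge lo1 _ _; lra.
apply: (le_trans (ml_ratio_le a01 m0 y0L)).
near: d; apply: cvgr_le hi1 _ _; lra.
Unshelve. all: by end_near. Qed.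

(** This controls the amplification of the noise. *)
Lemma ml_inv_le a m y L : 0 < a < 1 -> 0 <= m -> 0 < y < L ->
  (ml a (m * y `^ a))^-1 <= 1 + Gamma (1 - a) * (m * (L + 1)).
Proof.
move=> a01 m0 /andP[y0 yL]; have x0 : 0 <= m * y `^ a by rewrite mulr_ge0 ?powR_ge0.
have /andP[a0 a1] := a01; have b0 : 0 < 1 - a by rewrite subr_gt0.
have G0 : 0 < Gamma (1 - a) by rewrite Gamma_gt0.
have d0 : 0 < 1 + Gamma (1 - a) * (m * y `^ a) by rewrite ltr_pwDl// mulr_ge0// ltW.
apply: (@le_trans _ _ (1 + Gamma (1 - a) * (m * y `^ a))).
  rewrite -[leRHS]invrK lef_pV2 ?posrE ?invr_gt0 ?ml_gt0//.
  exact: mittag_leffler_ge_rational.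
rewrite lerD2l ler_pM2l// ler_wpM2l// (le_trans (powR_le_add a01 y0))//; lra.
Qed.

(** If m (1 - a) <= 1, the Jensen bound shows that the ratio is at most
    exp(L + 2). Otherwise Gamma(1 - a) <= 1 / (1 - a) < m, and the rational bound
    gives 1 + m^2 y^a exp(- m y) <= 1 + m^(2-a). *)
Lemma ml_ratio_dom k L q : 0 < k -> 0 < L -> 0 < q -> exists2 K, 0 < K &
  forall a m y, 0 < a < 1 -> 1 - a <= q -> k <= m -> 0 < y < L ->
    expR (- (m * y)) / ml a (m * y `^ a) <= K * m `^ (1 + q).
Proof.
move=> k0 L0 q0; have kq : 0 < k `^ (1 + q) by rewrite powR_gt0.
exists (expR (L + 2) / k `^ (1 + q) + 2) => [|a m y a01 aq km y0L].
  by rewrite ltr_wpDl// divr_ge0 ?expR_ge0// ltW.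
have m0 : 0 < m by exact: lt_le_trans km.
have /andP[a0 a1] := a01; have b0 : 0 < 1 - a by rewrite subr_gt0.
have /andP[y0 yL] := y0L.
have mq : 0 < m `^ (1 + q) by rewrite powR_gt0.
rewrite mulrDl.
have [bm|bm] := leP (m * (1 - a)) 1.
  apply: (@le_trans _ _ (expR (L + 2) / k `^ (1 + q) * m `^ (1 + q))); last first.
    by rewrite lerDl mulr_ge0// ltW.
  apply: (le_trans (ml_ratio_le a01 (ltW m0) y0L)).
  apply: (@le_trans _ _ (expR (L + 2))).
    by rewrite ler_expR ler_piMl//; lra.
  rewrite -mulrA ler_peMr ?expR_ge0// mulrC ler_pdivlMr// mul1r.
  by rewrite ge0_ler_powR ?nnegrE ?(ltW k0) ?(ltW m0) ?addr_ge0 ?(ltW q0).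
have m1 : 1 <= m by nra.
apply: (@le_trans _ _ (2 * m `^ (1 + q))); last first.
  by rewrite lerDr mulr_ge0 ?divr_ge0 ?expR_ge0// ltW.
have x0 : 0 <= m * y `^ a by rewrite mulr_ge0 ?powR_ge0// ltW.
have G0 : 0 < Gamma (1 - a) by rewrite Gamma_gt0.
have Gm : Gamma (1 - a) <= m.
  apply: (le_trans (Gamma_onem_le a01)).
  by rewrite -div1r ler_pdivrMr// ltW.
have d0 : 0 < 1 + Gamma (1 - a) * (m * y `^ a) by rewrite ltr_pwDl// mulr_ge0// ltW.
have h1 : (ml a (m * y `^ a))^-1 <= 1 + m * (m * y `^ a).
  apply: (@le_trans _ _ (1 + Gamma (1 - a) * (m * y `^ a))).
    rewrite -[leRHS]invrK lef_pV2 ?posrE ?invr_gt0 ?ml_gt0//.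
    exact: mittag_leffler_ge_rational.
  by rewrite lerD2l ler_wpM2r.
apply: (le_trans (ler_wpM2l (expR_ge0 _) h1)).
rewrite mulrDr mulr1.
have mq1 : 1 <= m `^ (1 + q).
  by rewrite -[leLHS](powRr0 m) ler_powR// addr_ge0// ltW.
have e1 : expR (- (m * y)) <= 1 by rewrite expR_le1 oppr_le0 mulr_ge0// ltW.
have E : m * (m * y `^ a) = m `^ (2 - a) * (m * y) `^ a.
  rewrite powRM ?ltW// mulrA [RHS]mulrA -powRD ?subrK; last by rewrite gt_eqF ?implybT.
  by rewrite -[2]/(2%:R) powR_mulrn ?ltW.
have e2 : expR (- (m * y)) * (m * y) `^ a <= 1.
  rewrite expRN mulrC ler_pdivrMr ?expR_gt0// mul1r.
  apply: le_trans (expR_ge1Dx _); apply: (le_trans (powR_le_add a01 (mulr_gt0 m0 y0))); lra.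
have e3 : m `^ (2 - a) <= m `^ (1 + q) by rewrite ler_powR//; lra.
rewrite E mulrCA.
have : m `^ (2 - a) * (expR (- (m * y)) * (m * y) `^ a) <= m `^ (1 + q) * 1.
  by apply: ler_pM; rewrite ?powR_ge0 ?mulr_ge0 ?expR_ge0 ?powR_ge0.
lra.
Qed.
End ratio.

(** * Orthonormal expansions in L2 *)

Section L2_spectral.
Context (R : realType) (d : nat) (Om : lipschitz_domain R d).
Implicit Types (v w : 'rV[R]_d -> R) (a : R).

Notation ip := (L2ip Om).

Lemma L2_lincomb v w a : v \in L2 Om -> w \in L2 Om ->
  (fun x => a * v x + w x) \in L2 Om.
Proof.
have p1 : (1 <= 2%:E :> \bar R)%E by rewrite lee_fin ler1n.
move=> hv hw; exact: (@Lfun_submod_closed _ _ R (dom_measure Om) 2%:E p1).2 a v w hv hw.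
Qed.

Lemma L2_0 : (fun=> 0) \in L2 Om.
Proof.
have p1 : (1 <= 2%:E :> \bar R)%E by rewrite lee_fin ler1n.
exact: (@Lfun_submod_closed _ _ R (dom_measure Om) 2%:E p1).1.
Qed.

Lemma L2_scale v a : v \in L2 Om -> (fun x => a * v x) \in L2 Om.
Proof.
move=> hv; have := L2_lincomb a hv L2_0.
by rewrite (_ : (fun x => a * v x + 0) = fun x => a * v x)//; apply/funext => x; rewrite addr0.
Qed.

Lemma L2_sub v w : v \in L2 Om -> w \in L2 Om -> v \- w \in L2 Om.
Proof.
move=> hv hw; have := L2_lincomb (-1) hw hv.
rewrite (_ : (fun x => -1 * w x + v x) = v \- w)//.
by apply/funext => x; rewrite mulN1r addrC.
Qed.

Lemma L2_sum v (c : nat -> R) (phi : nat -> 'rV[R]_d -> R) n : v \in L2 Om ->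
  (forall j, phi j \in L2 Om) ->
  (fun x => v x - \sum_(0 <= j < n) c j * phi j x) \in L2 Om.
Proof.
move=> hv hphi; elim: n => [|n IH].
  rewrite (_ : (fun _ => _) = v)//; apply/funext => x; by rewrite big_geq// subr0.
have := L2_lincomb (- c n) (hphi n) IH.
rewrite (_ : (fun _ => _) = fun x => v x - \sum_(0 <= j < n.+1) c j * phi j x)//.
by apply/funext => x; rewrite big_nat_recr//=; ring.
Qed.

Lemma L2ip_integrable v w : v \in L2 Om -> w \in L2 Om ->
  (dom_measure Om).-integrable setT (fun x => (v x * w x)%:E).
Proof. by move=> hv hw; apply/Lfun1_integrable; exact: Lfun2_mul_Lfun1. Qed.

Lemma L2ipC v w : ip v w = ip w v.
Proof. by apply: eq_Rintegral => x _; rewrite mulrC. Qed.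

Lemma L2ip_linear v w z a : v \in L2 Om -> w \in L2 Om -> z \in L2 Om ->
  ip (fun x => a * v x + w x) z = a * ip v z + ip w z.
Proof.
move=> hv hw hz; rewrite /L2ip -RintegralZl//; last exact: L2ip_integrable.
rewrite -RintegralD//; first by apply: eq_Rintegral => x _; ring.
  under eq_fun do rewrite mulrA.
  exact: L2ip_integrable (L2_scale a hv) hz.
exact: L2ip_integrable.
Qed.

Lemma L2ip0 z : ip (fun=> 0) z = 0.
Proof.
by rewrite /L2ip /Rintegral; under eq_integral do rewrite mul0r; rewrite integral0.
Qed.

Lemma L2ip_scale v z a : v \in L2 Om -> z \in L2 Om -> ip (fun x => a * v x) z = a * ip v z.
Proof.
move=> hv hz; have := L2ip_linear a hv L2_0 hz; rewrite L2ip0 addr0 => <-.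
by congr L2ip; apply/funext => x; rewrite addr0.
Qed.

Lemma L2ip_sub v w z : v \in L2 Om -> w \in L2 Om -> z \in L2 Om ->
  ip (v \- w) z = ip v z - ip w z.
Proof.
move=> hv hw hz; rewrite -mulN1r addrC -L2ip_linear//.
by congr L2ip; apply/funext => x; rewrite mulN1r addrC.
Qed.

Lemma L2ip_ge0 v : 0 <= ip v v.
Proof. by apply: Rintegral_ge0 => x _; rewrite -expr2 sqr_ge0. Qed.

Lemma L2normE v : v \in L2 Om -> L2norm Om v = (Num.sqrt (ip v v))%:E.
Proof.
move=> hv; rewrite /L2norm unlock.
have -> : (\int[dom_measure Om]_x `|(EFin \o v) x| `^ 2)%E = (ip v v)%:E.
  rewrite /L2ip /Rintegral fineK; last first.
    by apply: integrable_fin_num => //; exact: L2ip_integrable.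
  apply: eq_integral => x _ /=; rewrite -expr2 -[in LHS]/(2%:R).
  by rewrite powR_mulrn// real_normK// num_real.
by rewrite poweR_EFin powR12_sqrt// L2ip_ge0.
Qed.

Section orthonormal.
Variable phi : nat -> 'rV[R]_d -> R.
Hypothesis phiL2 : forall j, phi j \in L2 Om.
Hypothesis phiO : forall i j, ip (phi i) (phi j) = (i == j)%:R.

(** Subtracting a partial sum of any orthonormal series changes only the first n
    coefficients; with c the coefficients of v this gives Bessel's inequality,
    and with other c the uniqueness of the expansion. *)
Lemma coef_residual v (c : nat -> R) n k : v \in L2 Om ->
  coef Om phi (fun x => v x - \sum_(0 <= j < n) c j * phi j x) k =
  coef Om phi v k - (if (k < n)%N then c k else 0).
Proof.
move=> hv; elim: n => [|n IH].
  by rewrite subr0; congr L2ip; apply/funext => x; rewrite big_geq// subr0.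
rewrite /coef (_ : (fun _ => _) = fun x => - c n * phi n x +
    (v x - \sum_(0 <= j < n) c j * phi j x)); last first.
  by apply/funext => x; rewrite big_nat_recr//=; ring.
rewrite L2ip_linear//; last exact: L2_sum.
move: IH; rewrite /coef => ->; rewrite phiO.
have -> : (k < n.+1)%N = (n == k) || (k < n)%N by rewrite ltnS leq_eqVlt eq_sym.
by have [->|nk] := eqVneq n k; rewrite /= ?ltnn; ring.
Qed.

Lemma bessel v n : v \in L2 Om -> \sum_(0 <= j < n) coef Om phi v j ^+ 2 <= ip v v.
Proof.
move=> hv; pose r n x := v x - \sum_(0 <= j < n) coef Om phi v j * phi j x.
have hr m : r m \in L2 Om by exact: L2_sum.
suff -> : \sum_(0 <= j < n) coef Om phi v j ^+ 2 = ip v v - ip (r n) (r n).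
  by rewrite gerBl L2ip_ge0.
elim: n => [|n IH].
  rewrite big_geq// (_ : r 0%N = v) ?subrr//.
  by apply/funext => x; rewrite /r big_geq// subr0.
rewrite big_nat_recr//= IH.
have rE : r n.+1 = fun x => - coef Om phi v n * phi n x + r n x.
  by apply/funext => x; rewrite /r big_nat_recr//=; ring.
have rn : ip (r n) (phi n) = coef Om phi v n.
  by have := coef_residual (coef Om phi v) n n hv; rewrite ltnn subr0.
have e1 : ip (r n.+1) (phi n) = 0.
  by rewrite rE L2ip_linear// rn phiO eqxx mulr1 addNr.
have e2 : ip (r n.+1) (r n.+1) = ip (r n.+1) (r n).
  transitivity (ip (fun x => - coef Om phi v n * phi n x + r n x) (r n.+1)).
    by rewrite -rE.
  by rewrite L2ip_linear// [ip (phi n) _]L2ipC e1 mulr0 add0r L2ipC.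
rewrite e2 rE L2ip_linear// [ip (phi n) _]L2ipC rn; ring.
Qed.

Lemma coef_sqr_le v j : v \in L2 Om -> coef Om phi v j ^+ 2 <= ip v v.
Proof.
move=> hv; apply: le_trans (bessel j.+1 hv).
by rewrite big_nat_recr//= lerDr sumr_ge0// => i _; rewrite sqr_ge0.
Qed.

Lemma coef_norm_le v j : v \in L2 Om -> (`|coef Om phi v j|%:E <= L2norm Om v)%E.
Proof.
move=> hv; rewrite L2normE// lee_fin -sqrtr_sqr ler_sqrt ?L2ip_ge0//.
exact: coef_sqr_le.
Qed.

(** The k-th coefficient of the residual is eventually coef v k - c k, and it is
    bounded by the norm of the residual, which tends to 0. *)
Lemma coef_L2sum c v j : L2sum Om phi c v -> coef Om phi v j = c j.
Proof.
move=> [hv h]; apply/eqP; rewrite -subr_eq0 -normr_eq0 eq_le normr_ge0 andbT.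
rewrite -lee_fin.
have : (`|coef Om phi v j - c j|%:E @[n --> \oo] --> `|coef Om phi v j - c j|%:E)%E.
  exact: cvg_cst.
move=> h0; apply: (lee_cvg_to h0 h); near=> n.
have jn : (j < n)%N by near: n; exists j.+1.
have := coef_norm_le j (L2_sum c n hv phiL2).
by rewrite coef_residual// jn.
Unshelve. all: by end_near. Qed.

End orthonormal.
End L2_spectral.

(** * Spectral coefficients of the solution of the Cauchy problem *)

Section ode.
Context {R : realType}.
Implicit Types (P w : R -> R) (ell m y : R).

(** The boundary value at 0 is only known as a one-sided limit. *)
Lemma derive0_eq_limit P ell l : (forall y, 0 < y < ell -> is_derive y (1 : R) P 0) ->
  P y @[y --> 0^'+] --> l -> forall y, 0 < y < ell -> P y = l.
Proof.
move=> dP Pl y /andP[y0 yl].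
have cstP x : 0 < x < y -> P x = P y.
  move=> /andP[x0 xy].
  have in_ell z : z \in `[x, y] -> 0 < z < ell.
    rewrite in_itv/= => /andP[xz zy].
    by rewrite (lt_le_trans x0 xz) (le_lt_trans zy yl).
  have dPi z : z \in `]x, y[ -> is_derive z (1 : R) P 0.
    by move=> zi; apply: dP; apply: in_ell; exact: subset_itv_oo_cc.
  have cP : {within `[x, y], continuous P}.
    by apply: derivable_within_continuous => z /in_ell zi; have [] := dP z zi.
  have [z _] := @MVT R P (fun=> 0) x y xy dPi cP.
  by rewrite mul0r => /eqP; rewrite subr_eq0 eq_sym => /eqP.
suff h : P x @[x --> 0^'+] --> P y by apply/esym; exact: (cvg_unique _ Pl h).
apply: cvg_near_cst; near=> x.
rewrite cstP//; apply/andP; split; near: x.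
  exact: nbhs_right_gt.
exact: nbhs_right_lt.
Unshelve. all: by end_near. Qed.

(** For s = m and s = - m the function (w' - s w) exp(s y) has derivative 0, so it
    equals its limit at 0; the two identities determine w. *)
Lemma exp_ode w ell m (f0 g0 : R) : 0 < m ->
  (forall y, 0 < y < ell -> [/\ derivable w y 1, derivable (derive1 w) y 1 &
     derive1 (derive1 w) y = m ^+ 2 * w y]) ->
  w y @[y --> 0^'+] --> f0 -> derive1 w y @[y --> 0^'+] --> g0 ->
  forall y, 0 < y < ell ->
    w y = (f0 + g0 / m) / 2 * expR (m * y) + (f0 - g0 / m) / 2 * expR (- m * y).
Proof.
move=> m0 hw wf wg y hy.
(* used for both roots s = m and s = - m *)
have key (s : R) : s ^+ 2 = m ^+ 2 ->
    (derive1 w y - s * w y) * expR (s * y) = g0 - s * f0.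
  move=> s2; pose P y := (derive1 w y - s * w y) * expR (s * y).
  apply: (@derive0_eq_limit P ell _ _ _ y hy) => [z /hw[d1 d2 e]|].
    have i1 : is_derive z (1 : R) w (derive1 w z) by rewrite derive1E; exact: derivableP.
    have i2 : is_derive z (1 : R) (derive1 w) (m ^+ 2 * w z).
      by rewrite -e [in X in is_derive _ _ _ X]derive1E; exact: derivableP.
    have i3 : is_derive z (1 : R) (fun y => expR (s * y)) (s * expR (s * z)).
      by apply: is_derive_eq; rewrite /GRing.scale /=; ring.
    have i4 : is_derive z (1 : R) (fun y => derive1 w y - s * w y) (m ^+ 2 * w z - s * derive1 w z).
      by apply: is_derive_eq; rewrite /GRing.scale /=.
    rewrite /P; apply: is_derive_eq.
    rewrite /GRing.scale /= -s2; ring.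
  rewrite /P [X in _ --> X](_ : _ = (g0 - s * f0) * expR (s * 0)); last first.
    by rewrite mulr0 expR0 mulr1.
  apply: cvgM.
    by apply: cvgB => //; apply: cvgM => //; exact: cvg_cst.
  apply: cvg_at_right_filter.
  apply: (cvg_comp (fun y => s * y) expR); last exact: continuous_expR.
  by apply: cvgM; [exact: cvg_cst|exact: cvg_id].
have k1 := key m erefl.
have k2 := key (- m) (sqrrN m).
have E : expR (m * y) * expR (- m * y) = 1 by rewrite -expRD mulNr subrr expR0.
have e1 : derive1 w y - m * w y = (g0 - m * f0) * expR (- m * y).
  by rewrite -k1 -mulrA E mulr1.
have e2 : derive1 w y + m * w y = (g0 + m * f0) * expR (m * y).
  rewrite (_ : g0 + m * f0 = g0 - - m * f0); last by ring.
  by rewrite -k2 -mulrA [expR (- m * y) * _]mulrC E; ring.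
have m2 : 2 * m != 0 by rewrite mulf_neq0 ?gt_eqF.
apply: (mulfI m2); rewrite (_ : 2 * m * w y = (derive1 w y + m * w y) - (derive1 w y - m * w y)); last by ring.
by rewrite e1 e2; field; rewrite gt_eqF.
Qed.
End ode.

Section solution_coef.
Context (R : realType) (d : nat) (Om : lipschitz_domain R d).
Variables (lam : nat -> R) (phi : nat -> 'rV[R]_d -> R).
Hypothesis eig : dirichlet_eigensystem Om lam phi.

Lemma eigenfunction_L2 j : phi j \in L2 Om.
Proof. by have [G [[]]] := eigensystem_pair eig j. Qed.

(** Test the equation with phi_j and use the weak eigenvalue equation of phi_j
    with u(y) as test function: the coefficient w of u(y) solves w'' = lam_j w. *)
Lemma coef_solution ell (f g h : 'rV[R]_d -> R) u : f \in L2 Om -> g \in L2 Om ->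
  laplace_pow Om lam phi (- 2^-1) g h -> cauchy_solution Om ell f g u ->
  forall y, 0 < y < ell -> u y \in L2 Om /\ forall j,
  coef Om phi (u y) j =
    coef Om phi (fun x => (f x + h x) / 2) j * expR (Num.sqrt (lam j) * y) +
    coef Om phi (fun x => (f x - h x) / 2) j * expR (- Num.sqrt (lam j) * y).
Proof.
move=> hf hg hh [G [hG hu]] y hy; split=> [|j]; first by have [] := hG y hy.
have pL2 := eigenfunction_L2.
have [H [hH hE]] := eigensystem_pair eig j.
have l0 := eigensystem_gt0 eig j.
have m0 : 0 < Num.sqrt (lam j) by rewrite sqrtr_gt0.
have m2 : Num.sqrt (lam j) ^+ 2 = lam j by rewrite sqr_sqrtr// ltW.
have [hL2 _] := hh.
have hc : coef Om phi h j = coef Om phi g j / Num.sqrt (lam j).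
  rewrite (coef_L2sum pL2 (eigensystem_orthonormal eig) j hh).
  by rewrite powRN powR12_sqrt ?ltW// mulrC.
have [_ wf wg] : [/\ True, L2ip Om (u y) (phi j) @[y --> 0^'+] --> L2ip Om f (phi j) &
    derive1 (fun y => L2ip Om (u y) (phi j)) y @[y --> 0^'+] --> L2ip Om g (phi j)].
  by have [] := hu _ _ hH.
rewrite /coef (exp_ode m0 _ wf wg hy); last first.
  move=> z hz; have [/(_ z hz)[d1 d2 e] _ _] := hu _ _ hH; split => //.
  rewrite e m2 L2ipC -(hE _ _ (hG z hz)).
  by apply: eq_bigr => i _; rewrite L2ipC.
have e1 : L2ip Om (fun x => (f x + h x) / 2) (phi j) =
    (coef Om phi f j + coef Om phi g j / Num.sqrt (lam j)) / 2.
  rewrite -hc (_ : (fun x => _) = (fun x => 2^-1 * f x + 2^-1 * h x)); last first.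
    by apply/funext => x; ring.
  by rewrite L2ip_linear ?L2_scale// L2ip_scale// /coef; ring.
have e2 : L2ip Om (fun x => (f x - h x) / 2) (phi j) =
    (coef Om phi f j - coef Om phi g j / Num.sqrt (lam j)) / 2.
  rewrite -hc (_ : (fun x => _) = (fun x => 2^-1 * f x + - 2^-1 * h x)); last first.
    by apply/funext => x; ring.
  by rewrite L2ip_linear ?L2_scale// L2ip_scale// /coef; ring.
by rewrite e1 e2.
Qed.
End solution_coef.

(** * Landweber iteration on spectral coefficients *)

Section landweber_coef.
Context (R : realType) (d : nat) (Om : lipschitz_domain R d).
Variables (lam : nat -> R) (phi : nat -> 'rV[R]_d -> R).
Hypothesis eig : dirichlet_eigensystem Om lam phi.
Variables (s mu : R) (B A : ('rV[R]_d -> R) -> 'rV[R]_d -> R).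
Hypothesis mu0 : 0 < mu.
Hypothesis hB : forall v : 'rV[R]_d -> R, v \in L2 Om -> laplace_pow Om lam phi (- s) v (B v).
Hypothesis hA : A = fun v x => mu * B v x.

(** The eigenvalue of A on phi_j. *)
Definition landweber_symbol j : R := mu * lam j `^ (- s).

Lemma coef_sub v w j : v \in L2 Om -> w \in L2 Om ->
  coef Om phi (v \- w) j = coef Om phi v j - coef Om phi w j.
Proof. by move=> hv hw; apply: L2ip_sub => //; exact: eigenfunction_L2 eig j. Qed.

Lemma smoothing_coef v : v \in L2 Om ->
  A v \in L2 Om /\ forall j, coef Om phi (A v) j = landweber_symbol j * coef Om phi v j.
Proof.
move=> hv; have hBv := hB hv; have [BL2 _] := hBv.
rewrite hA; split=> [|j]; first exact: L2_scale.
have pL2 := eigenfunction_L2 eig.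
rewrite [LHS]L2ip_scale//; have := coef_L2sum pL2 (eigensystem_orthonormal eig) j hBv.
by rewrite /coef /landweber_symbol => ->; rewrite mulrA.
Qed.

Lemma landweber_coef v i : v \in L2 Om ->
  landweber A v i \in L2 Om /\ forall j, coef Om phi (landweber A v i) j =
    (1 - (1 - landweber_symbol j) ^+ i) * coef Om phi v j.
Proof.
move=> hv; have pL2 := eigenfunction_L2 eig.
elim: i => [|i [IH1 IH2]] /=.
  split=> [|j]; first exact: L2_0.
  by rewrite expr0 subrr mul0r; exact: L2ip0.
have hr := L2_sub IH1 hv.
have [hA1 hA2] := smoothing_coef hr.
split=> [|j]; first exact: L2_sub.
by rewrite coef_sub// hA2 coef_sub// IH2 exprS; ring.
Qed.

Lemma landweber_symbol_gt0 j : 0 < landweber_symbol j.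
Proof. by rewrite mulr_gt0 ?powR_gt0 ?(eigensystem_gt0 eig). Qed.

Hypothesis hA1 : forall v : 'rV[R]_d -> R, v \in L2 Om -> (L2norm Om (A v) <= L2norm Om v)%E.

(** Apply the bound on the norm of A to phi_j. *)
Lemma landweber_symbol_le1 j : landweber_symbol j <= 1.
Proof.
have pL2 := eigenfunction_L2 eig; have pO := eigensystem_orthonormal eig.
have [h1 h2] := smoothing_coef (pL2 j).
have := le_trans (coef_norm_le pL2 pO j h1) (hA1 (pL2 j)).
rewrite h2 L2normE// /coef pO eqxx sqrtr1 mulr1 lee_fin.
by rewrite ger0_norm// ltW// landweber_symbol_gt0.
Qed.

(** The norm bound on A keeps the eigenvalues away from 0. *)
Lemma eigenvalue_ge : 0 < s -> forall j, mu `^ s^-1 <= lam j.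
Proof.
move=> s0 j; have l0 := eigensystem_gt0 eig j.
have := landweber_symbol_le1 j.
rewrite /landweber_symbol powRN ler_pdivrMr ?powR_gt0// mul1r => h.
rewrite -[leRHS](powRr1 (ltW l0)) -(mulfV (lt0r_neq0 s0)) powRrM.
by apply: ge0_ler_powR => //; rewrite ?nnegrE ?powR_ge0 ?invr_ge0 ?(ltW mu0) ?(ltW s0).
Qed.
End landweber_coef.

(** * Integrals and series of nonnegative terms *)

Section integral_domination.
Context {R : realType}.
Notation leb := (@lebesgue_measure R).

(** Monotonicity without measurability of f1: the integral of a nonnegative
    function is a supremum over the simple functions below it. It spares a proof
    that the reconstruction error is measurable in y. *)
Lemma ge0_le_integral_nonmeas (D : set R) (f1 f2 : R -> \bar R) :
  (forall x, D x -> (0 <= f1 x)%E) -> (forall x, D x -> (f1 x <= f2 x)%E) ->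
  (\int[leb]_(x in D) f1 x <= \int[leb]_(x in D) f2 x)%E.
Proof.
move=> f0 f12; rewrite !ge0_integralE//; last first.
  by move=> x Dx; exact: le_trans (f0 _ Dx) (f12 _ Dx).
apply: le_ereal_sup => _ [h hf <-]; exists h => // x.
apply: (le_trans (hf x)); rewrite /patch; case: ifPn => // xD.
by apply: f12; rewrite inE in xD.
Qed.

(** The majorant is a series of measurable functions with nonnegative
    coefficients, so it is integrated term by term. *)
Lemma integral_le_series_add (ell c : R) (F : R -> \bar R) (b : nat -> R)
    (W : nat -> R -> R) : 0 < ell -> 0 <= c -> (forall j, 0 <= b j) ->
  (forall j y, 0 <= W j y) -> (forall j, measurable_fun setT (W j)) ->
  (forall y, 0 < y < ell -> (0 <= F y <= \sum_(0 <= j <oo) (b j * W j y)%:E + c%:E)%E) ->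
  (\int[leb]_(y in `]0%R, ell[) F y <=
   \sum_(0 <= j <oo) ((b j)%:E * \int[leb]_(y in `]0%R, ell[) (W j y)%:E) + (c * ell)%:E)%E.
Proof.
move=> ell0 c0 b0 W0 mW hF.
have mD : measurable (`]0%R, ell[%classic : set R) by exact: measurable_itv.
have mWD j : measurable_fun (`]0%R, ell[%classic : set R) (fun y : R => (W j y)%:E).
  by apply: measurable_funTS; apply/measurable_EFinP.
have mbW j : measurable_fun (`]0%R, ell[%classic : set R) (fun y : R => (b j * W j y)%:E).
  by apply: measurable_funTS; apply/measurable_EFinP; exact: measurable_funM.
have bW0 j y : (0 <= (b j * W j y)%:E)%E by rewrite lee_fin mulr_ge0.
apply: (@le_trans _ _ (\int[leb]_(y in `]0%R, ell[)
    (\sum_(0 <= j <oo) (b j * W j y)%:E + c%:E))%E).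
  by apply: ge0_le_integral_nonmeas => y; rewrite /= in_itv/= => /hF /andP[].
rewrite ge0_integralD//=; last first.
  by apply: (@ge0_emeasurable_sum _ _ _ _ (fun j y => (b j * W j y)%:E) xpredT).
  by move=> y _; apply: nneseries_ge0 => j _ _.
apply: leeD.
  rewrite integral_nneseries//.
  apply: lee_nneseries => [j _ _|j _]; first by apply: integral_ge0 => y _.
  under eq_integral do rewrite EFinM.
  rewrite (@ge0_integralZl_EFin _ _ _ leb _ _ (fun y => (W j y)%:E))//.
  - by move=> y _; rewrite lee_fin.
  - exact: mWD.
rewrite [leLHS](_ : _ = (c%:E * leb `]0%R, ell[)%E); last by rewrite -integral_cst.
by rewrite lebesgue_measure_itv/= lte_fin ell0 oppr0 adde0 EFinM.
Qed.

(** Dominated convergence for series is applied in this form: a small factor e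
    on the first n terms and a bounded factor K on a small tail. *)
Lemma series_two_level (w : nat -> \bar R) (e K : R) n : 0 <= e -> 0 <= K ->
  (forall j, (0 <= w j)%E) ->
  (\sum_(0 <= j <oo) ((if (j < n)%N then e else K)%:E * w j) <=
   e%:E * \sum_(0 <= j <oo) w j + K%:E * \sum_(n <= j <oo) w j)%E.
Proof.
move=> e0 K0 w0.
have nn j : (0 <= (if (j < n)%N then e else K)%:E * w j)%E.
  by apply: mule_ge0 => //; case: ifP; rewrite lee_fin.
rewrite (@nneseries_split _ (fun j => (if (j < n)%N then e else K)%:E * w j)%E 0 n)//.
rewrite add0n; apply: leeD.
  rewrite -nneseriesZl//.
  apply: le_trans (@nneseries_lim_ge _ _ xpredT 0 n _); last first.
    by move=> j _ _; rewrite mule_ge0.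
  by rewrite big_nat_cond [leRHS]big_nat_cond; apply: lee_sum => j /andP[/andP[_ ->] _].
rewrite -nneseriesZl//.
apply: lee_lim; [exact: is_cvg_nneseries|apply: is_cvg_nneseries => j _ _; exact: mule_ge0|].
apply: nearW => m; rewrite big_nat_cond [leRHS]big_nat_cond.
by apply: lee_sum => j /andP[/andP[nj _] _]; rewrite ltnNge nj.
Qed.

Lemma ereal_cvg0 (T : Type) (F : set_system T) {FF : Filter F} (f : T -> \bar R) :
  (forall x, (0 <= f x)%E) -> (forall e, 0 < e -> \forall x \near F, (f x <= e%:E)%E) ->
  f x @[x --> F] --> 0%E.
Proof.
move=> f0 h; apply/fine_cvgP; split.
  have := h 1 ltr01; apply: filterS => x hx.
  by rewrite ge0_fin_numE// (le_lt_trans hx)// ltry.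
apply/cvgrPdist_le => e e0; have := h e e0; apply: filterS => x hx /=.
rewrite sub0r normrN ger0_norm ?fine_ge0//.
by rewrite -lee_fin fineK// ge0_fin_numE// (le_lt_trans hx)// ltry.
Qed.
End integral_domination.

(** * Limits along the noise level *)

Section rates.
Context {R : realType}.
Variables (N l : R) (istar : R -> nat).
Hypotheses (N0 : 0 < N) (l0 : 0 < l).

(** (1 - a)^i <= exp(- a i), and i exceeds any given number once delta is small. *)
Lemma landweber_residual_cvg0 (a c1 : R) : 0 < a <= 1 -> 0 < c1 ->
  (\forall delta \near 0^'+, c1 * (l ^- 2 * ln (N / delta)) <= (istar delta)%:R) ->
  forall e, 0 < e -> \forall delta \near 0^'+, (1 - a) ^+ istar delta <= e.
Proof.
move=> /andP[a0 a1] c10 hi e e0; pose c := c1 * l ^- 2.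
have c0 : 0 < c by rewrite mulr_gt0// invr_gt0 exprn_gt0.
(* the number of steps at which exp(- a i) falls below e *)
pose X := - ln e / a.
near=> delta.
have d0 : 0 < delta by near: delta; exact: nbhs_right_gt.
have dN : delta <= N * expR (- (X / c)).
  by near: delta; apply: nbhs_right_le; rewrite mulr_gt0 ?expR_gt0.
have hX : X <= (istar delta)%:R.
  apply: (@le_trans _ _ (c1 * (l ^- 2 * ln (N / delta)))); last by near: delta.
  rewrite mulrA -/c mulrC -ler_pdivrMr// -ler_expR lnK ?posrE ?divr_gt0//.
  rewrite ler_pdivlMr// -ler_pdivlMl ?expR_gt0// -expRN mulrC//.
apply: (@le_trans _ _ (expR (- a) ^+ istar delta)).
  by rewrite lerXn2r ?nnegrE ?expR_ge0 ?subr_ge0// expR_ge1Dx.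
rewrite -expRM_natr -[leRHS](lnK (e0 : e \is Num.pos)) ler_expR mulNr lerNl.
by rewrite -[leLHS](divfK (lt0r_neq0 a0)) mulrC ler_pM2l// -mulNr.
Unshelve. all: by end_near. Qed.

(** The step count times delta^2 is at most a constant times td^2, and at most a
    constant times delta because ln r < r. *)
Lemma landweber_noise_cvg0 (c2 C2 A B : R) (G td : R -> R) : 0 < c2 -> 0 < C2 ->
  0 <= A -> 0 <= B ->
  (\forall delta \near 0^'+, (istar delta)%:R <= c2 * (l ^- 2 * ln (N / delta))) ->
  td = (fun delta => C2 * l^-1 * delta * Num.sqrt (ln (N / delta))) ->
  G delta * td delta @[delta --> 0^'+] --> (0 : R) ->
  (istar delta)%:R * delta ^+ 2 * (A + B * G delta ^+ 2) @[delta --> 0^'+] --> (0 : R).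
Proof.
move=> c20 C20 A0 B0 hi tdE hG.
pose up delta := A * (c2 * l ^- 2 * N * delta) + B * (c2 / C2 ^+ 2 * (G delta * td delta) ^+ 2).
have hup : up delta @[delta --> 0^'+] --> (0 : R).
  rewrite [X in _ --> X](_ : _ = A * (c2 * l ^- 2 * N * 0) + B * (c2 / C2 ^+ 2 * (0 * 0))); last by ring.
  apply: cvgD.
    apply: cvgM; first exact: cvg_cst.
    apply: cvgM; first exact: cvg_cst.
    by apply: cvg_at_right_filter; exact: cvg_id.
  apply: cvgM; first exact: cvg_cst.
  apply: cvgM; first exact: cvg_cst.
  by under eq_fun do rewrite expr2; exact: cvgM.
apply: (squeeze_cvgr _ (cvg_cst 0) hup); near=> delta.
have d0 : 0 < delta by near: delta; exact: nbhs_right_gt.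
have dN : delta <= N by near: delta; exact: nbhs_right_le.
have Nd0 : 0 < N / delta by rewrite divr_gt0.
have L0 : 0 <= ln (N / delta) by rewrite ln_ge0// ler_pdivlMr// mul1r.
have L1 : ln (N / delta) <= N / delta by rewrite ltW// ln_sublinear.
have hid : (istar delta)%:R <= c2 * (l ^- 2 * ln (N / delta)) by near: delta.
have l2 : 0 < l ^- 2 by rewrite invr_gt0 exprn_gt0.
have d2 : 0 <= delta ^+ 2 by rewrite sqr_ge0.
apply/andP; split.
  by rewrite mulr_ge0 ?mulr_ge0// addr_ge0// mulr_ge0// sqr_ge0.
have h1 : (istar delta)%:R * delta ^+ 2 <= c2 * l ^- 2 * N * delta.
  apply: (le_trans (ler_wpM2r d2 hid)).
  rewrite [leRHS](_ : _ = c2 * (l ^- 2 * (N / delta)) * delta ^+ 2); last first.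
    by field; rewrite !gt_eqF.
  by rewrite ler_wpM2r// ler_pM2l// ler_pM2l.
have h2 : (istar delta)%:R * delta ^+ 2 <= c2 / C2 ^+ 2 * td delta ^+ 2.
  apply: (le_trans (ler_wpM2r d2 hid)).
  rewrite tdE !exprMn sqr_sqrtr// le_eqVlt; apply/orP; left; apply/eqP.
  by field; rewrite !gt_eqF.
rewrite mulrDr /up lerD//; first by rewrite mulrC ler_wpM2l.
rewrite mulrCA ler_wpM2l// [leLHS]mulrC.
rewrite [leRHS](_ : _ = G delta ^+ 2 * (c2 / C2 ^+ 2 * td delta ^+ 2)); last by ring.
by rewrite ler_wpM2l// sqr_ge0.
Unshelve. all: by end_near. Qed.
End rates.

(** * Norms as spectral sums *)

Section spectral_sums.
Context (R : realType) (d : nat) (Om : lipschitz_domain R d).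
Variables (lam : nat -> R) (phi : nat -> 'rV[R]_d -> R).
Hypothesis eig : dirichlet_eigensystem Om lam phi.

Lemma Hs_norm_sqr s v : (Hs_norm Om lam phi s v `^ 2)%E =
  (\sum_(0 <= j <oo) (lam j `^ s * coef Om phi v j ^+ 2)%:E)%E.
Proof.
rewrite /Hs_norm -poweRrM mulVf// poweRe1//.
by apply: nneseries_ge0 => j _ _; rewrite lee_fin mulr_ge0 ?powR_ge0 ?sqr_ge0.
Qed.

Lemma bessel_series v : v \in L2 Om ->
  (\sum_(0 <= j <oo) (coef Om phi v j ^+ 2)%:E <= (L2ip Om v v)%:E)%E.
Proof.
move=> hv; apply: lime_le.
  by apply: is_cvg_nneseries => j _ _; rewrite lee_fin sqr_ge0.
apply: nearW => n; rewrite sumEFin lee_fin.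
exact: (bessel (eigenfunction_L2 eig) (eigensystem_orthonormal eig)).
Qed.

Lemma L2norm_le_sqr v (r : R) : v \in L2 Om -> 0 <= r -> (L2norm Om v <= r%:E)%E ->
  L2ip Om v v <= r ^+ 2.
Proof.
move=> hv r0; rewrite L2normE// lee_fin => h.
by rewrite -(sqr_sqrtr (L2ip_ge0 Om v)) lerXn2r ?nnegrE ?sqrtr_ge0.
Qed.
End spectral_sums.

(** * Estimates for a single spectral coefficient *)

Section pointwise.
Context {R : realType}.
Implicit Types (c dd q rho E e lam : R).

(** The stable contributions um cancel; the rest is split into approximation error
    and propagated noise. *)
Lemma error_sqr_le c dd q E e um : 0 < e -> 0 < E ->
  (c * e + um - (q * (c + dd) / E + um)) ^+ 2 <=
  2 * ((c * e) ^+ 2 * (1 - q * (e^-1 / E)) ^+ 2) + 2 * (q / E) ^+ 2 * dd ^+ 2.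
Proof.
move=> e0 E0.
set X := c * e * (1 - q * (e^-1 / E)); set Y := q / E * dd.
have -> : c * e + um - (q * (c + dd) / E + um) = X - Y.
  by rewrite /X /Y; field; rewrite !gt_eqF.
rewrite -exprMn -/X -mulrA -exprMn -/Y -subr_ge0.
rewrite (_ : _ - _ = (X + Y) ^+ 2) ?sqr_ge0//; ring.
Qed.

(** The second bound is Bernoulli's inequality. *)
Lemma landweber_filter_bounds (a : R) i : 0 <= a <= 1 -> 0 <= 1 - (1 - a) ^+ i <= 1 /\ 1 - (1 - a) ^+ i <= i%:R * a.
Proof.
move=> /andP[a0 a1]; have b0 : 0 <= 1 - a by rewrite subr_ge0.
have p0 : 0 <= (1 - a) ^+ i by rewrite exprn_ge0.
have p1 : (1 - a) ^+ i <= 1 by rewrite exprn_ile1// gerBl.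
split; first by rewrite subr_ge0 p1 gerBl.
elim: i {p0 p1} => [|i IH]; first by rewrite expr0 subrr mul0r.
rewrite exprS -natr1.
have p1 : (1 - a) ^+ i <= 1 by rewrite exprn_ile1// gerBl.
have : a * (1 - a) ^+ i <= a * 1 by rewrite ler_wpM2l.
lra.
Qed.

(** The bound i a on the filter pays for the weight lam^s and for the growth
    lam of the squared amplification factor. *)
Lemma noise_weight_le lam (l0 s mu : R) q E (G L : R) i : 0 < l0 -> l0 <= lam -> 0 < mu ->
  0 <= q <= 1 -> q <= i%:R * (mu * lam `^ (- (s + 1))) ->
  0 < E -> 0 <= G -> 0 <= L ->
  E^-1 <= 1 + G * (Num.sqrt lam * L) ->
  lam `^ s * (q / E) ^+ 2 <= i%:R * (2 * mu * (l0^-1 + L ^+ 2 * G ^+ 2)).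
Proof.
move=> l00 ll mu0 /andP[q0 q1] qi E0 G0 L0 hE.
have lam0 : 0 < lam by exact: lt_le_trans ll.
have E2 : E^-1 ^+ 2 <= 2 * (1 + G ^+ 2 * lam * L ^+ 2).
  have Ei : 0 <= E^-1 by rewrite invr_ge0 ltW.
  set Z := G * (Num.sqrt lam * L) in hE.
  have Z2 : Z ^+ 2 = G ^+ 2 * lam * L ^+ 2.
    by rewrite /Z !exprMn sqr_sqrtr ?ltW// mulrA.
  have Z0 : 0 <= Z by rewrite mulr_ge0// mulr_ge0 ?sqrtr_ge0.
  rewrite -Z2; apply: (@le_trans _ _ ((1 + Z) ^+ 2)).
    by rewrite lerXn2r ?nnegrE ?addr_ge0.
  have := sqr_ge0 (1 - Z); rewrite !expr2; lra.
have q2 : q ^+ 2 <= i%:R * (mu * lam `^ (- (s + 1))).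
  by apply: le_trans qi; rewrite expr2 ler_piMl.
have pw : lam `^ s * lam `^ (- (s + 1)) = lam^-1.
  rewrite -powRD; last by rewrite (gt_eqF lam0) implybT.
  by rewrite opprD addrA subrr sub0r powR_inv1 ?ltW.
rewrite exprMn.
apply: (@le_trans _ _ (lam `^ s * (i%:R * (mu * lam `^ (- (s + 1))) *
   (2 * (1 + G ^+ 2 * lam * L ^+ 2))))).
  rewrite ler_wpM2l ?powR_ge0//; apply: ler_pM => //; exact: sqr_ge0.
rewrite [leLHS](_ : _ = i%:R * (2 * mu * (lam `^ s * lam `^ (- (s + 1)) * (1 + G ^+ 2 * lam * L ^+ 2)))); last by ring.
rewrite pw ler_wpM2l// ler_wpM2l ?mulr_ge0 ?(ltW mu0)//.
rewrite mulrDr mulr1 lerD ?lef_pV2 ?posrE//.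
rewrite le_eqVlt; apply/orP; left; apply/eqP; field; rewrite gt_eqF//.
Qed.

Lemma one_sub_sqr_le q rho e : 0 <= q <= 1 -> 0 < e -> e <= 1 ->
  `|rho - 1| <= e -> 1 - q <= e -> (1 - q * rho) ^+ 2 <= 9 * e.
Proof.
move=> /andP[q0 q1] e0 e1; rewrite ler_distl => /andP[r1 r2] qe.
have : `|1 - q * rho| <= 3 * e.
  by rewrite ler_norml; apply/andP; split; nra.
move=> h; rewrite -real_normK ?num_real//.
have : `|1 - q * rho| ^+ 2 <= (3 * e) ^+ 2 by rewrite lerXn2r ?nnegrE// mulr_ge0// ltW.
rewrite !expr2; nra.
Qed.
End pointwise.

(** * Convergence of the reconstructions *)

Section assembly.
Context {R : realType}.

(** The approximation part keeps the weights of the a priori norm, with factors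
    beta to be made small; the noise part is summed by Bessel's inequality. *)
Lemma series_error_le (x c e r g dd lam beta : nat -> R) (sigma s Nn D : R) :
  (forall j, 0 < lam j) -> (forall j, 0 <= beta j) -> 0 <= Nn ->
  (forall j, x j ^+ 2 <= 2 * ((c j * e j) ^+ 2 * r j) + 2 * g j ^+ 2 * dd j ^+ 2) ->
  (forall j, r j <= beta j * lam j `^ s) ->
  (forall j, lam j `^ sigma * g j ^+ 2 <= Nn) ->
  (\sum_(0 <= j <oo) (dd j ^+ 2)%:E <= D%:E)%E ->
  (\sum_(0 <= j <oo) (lam j `^ sigma * x j ^+ 2)%:E <=
   \sum_(0 <= j <oo) ((2 * beta j) * (lam j `^ (sigma + s) * (c j * e j) ^+ 2))%:E
   + (2 * Nn * D)%:E)%E.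
Proof.
move=> l0 b0 Nn0 hx hr hg hD.
have t1 j : (0 <= ((2 * beta j) * (lam j `^ (sigma + s) * (c j * e j) ^+ 2))%:E)%E.
  rewrite lee_fin; apply: mulr_ge0; first exact: mulr_ge0.
  by apply: mulr_ge0; [exact: powR_ge0|exact: sqr_ge0].
have t2 j : (0 <= (2 * Nn)%:E * (dd j ^+ 2)%:E)%E.
  by rewrite -EFinM lee_fin mulr_ge0 ?sqr_ge0// mulr_ge0.
apply: (@le_trans _ _ (\sum_(0 <= j <oo) (((2 * beta j) * (lam j `^ (sigma + s) * (c j * e j) ^+ 2))%:E
   + (2 * Nn)%:E * (dd j ^+ 2)%:E))%E).
  apply: lee_nneseries => [j _ _|j _].
    by rewrite lee_fin mulr_ge0 ?powR_ge0 ?sqr_ge0.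
  rewrite -EFinM -EFinD lee_fin.
  apply: (le_trans (ler_wpM2l (powR_ge0 _ _) (hx j))).
  rewrite mulrDr; apply: lerD.
    rewrite powRD; last by rewrite (gt_eqF (l0 j)) implybT.
    rewrite [leRHS](_ : _ = lam j `^ sigma * (2 * ((c j * e j) ^+ 2 * (beta j * lam j `^ s)))); last by ring.
    by rewrite ler_wpM2l ?powR_ge0// ler_wpM2l// ler_wpM2l ?sqr_ge0.
  rewrite [leLHS](_ : _ = 2 * (lam j `^ sigma * g j ^+ 2) * dd j ^+ 2); last by ring.
  by rewrite ler_wpM2r ?sqr_ge0// ler_wpM2l.
rewrite nneseriesD//; apply: leeD => //.
rewrite nneseriesZl; last by move=> j _; rewrite lee_fin sqr_ge0.
rewrite (EFinM (2 * Nn)); apply: lee_wpmul2l => //.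
by rewrite lee_fin mulr_ge0.
Qed.

(** The constant 1 in (1 - q rho)^2 <= 1 + rho^2 is absorbed into a multiple of
    lam^s thanks to the lower bound l0 on the eigenvalues. *)
Lemma gain_sqr_le (lam l0 s K q rho : R) : 0 < l0 -> l0 <= lam -> 0 <= s -> 0 <= q <= 1 ->
  0 <= rho -> rho <= K * Num.sqrt lam `^ s ->
  (1 - q * rho) ^+ 2 <= (K ^+ 2 + (l0 `^ s)^-1) * lam `^ s.
Proof.
move=> l00 ll s0 /andP[q0 q1] r0 hr; have lam0 : 0 < lam by exact: lt_le_trans ll.
have e1 : (1 - q * rho) ^+ 2 <= 1 + rho ^+ 2.
  have : q * rho <= rho by rewrite ler_piMl.
  have : 0 <= q * rho by rewrite mulr_ge0.
  rewrite !expr2; nra.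
have e2 : (Num.sqrt lam `^ s) ^+ 2 = lam `^ s.
  by rewrite -powR12_sqrt ?ltW// -powRrM -powR_mulrn ?powR_ge0// -powRrM mulrAC mulVf// mul1r.
have e3 : rho ^+ 2 <= K ^+ 2 * lam `^ s.
  by rewrite -e2 -exprMn lerXn2r ?nnegrE// (le_trans r0).
have e4 : 1 <= (l0 `^ s)^-1 * lam `^ s.
  rewrite mulrC ler_pdivlMr ?powR_gt0// mul1r.
  by apply: ge0_ler_powR => //; rewrite nnegrE ltW.
by apply: (le_trans e1); rewrite mulrDl addrC lerD.
Qed.

Lemma sqrte_le (X : \bar R) (e : R) : 0 <= e -> (0 <= X)%E -> (X <= (e ^+ 2)%:E)%E ->
  (X `^ 2^-1 <= e%:E)%E.
Proof.
move=> e0 X0 h.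
have -> : e%:E = ((e ^+ 2)%:E `^ 2^-1)%E.
  by rewrite poweR_EFin powR12_sqrt ?sqr_ge0// sqrtr_sqr ger0_norm.
by apply: gt0_ler_poweR => //; rewrite ?in_itv/= ?X0 ?leey ?lee_fin ?sqr_ge0.
Qed.

Lemma near_forall_ltn (T : Type) (F : set_system T) {FF : Filter F} n (P : nat -> T -> Prop) :
  (forall j, \forall x \near F, P j x) -> \forall x \near F, forall j, (j < n)%N -> P j x.
Proof.
move=> hP; elim: n => [|n IH]; first by apply: nearW.
apply: filterS2 IH (hP n) => x h1 h2 j; rewrite ltnS leq_eqVlt => /orP[/eqP -> //|].
exact: h1.
Qed.
End assembly.

Unset Implicit Arguments.

Theorem theorem1p1 (R : realType) (d : nat) (hd : (0 < d)%N)
  (Om : lipschitz_domain R d) (ell : R) (hell : 0 < ell)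
  (lam : nat -> R) (phi : nat -> 'rV[R]_d -> R)
  (hphi : dirichlet_eigensystem Om lam phi)
  (sigma p : R) (hsigma : 0 <= sigma) (hp : 1 < p)
  (* Cauchy data, h = (- Delta)^(-1/2) g, splitting of the data *)
  (f g h : 'rV[R]_d -> R) (hf : f \in L2 Om) (hg : g \in L2 Om)
  (hh : laplace_pow Om lam phi (- 2^-1) g h)
  (up0 um0 : 'rV[R]_d -> R)
  (hup0 : up0 = fun x => (f x + h x) / 2) (hum0 : um0 = fun x => (f x - h x) / 2)
  (* exact solution and its unstable component *)
  (u up : R -> 'rV[R]_d -> R)
  (hu : cauchy_solution Om ell f g u)
  (hup : forall y : R, 0 < y < ell ->
     L2sum Om phi (fun j => coef Om phi up0 j * expR (Num.sqrt (lam j) * y)) (up y))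
  (hupreg : (L2Hs_norm Om lam phi ell (sigma + 1 + p^-1) up < +oo)%E)
  (hupn0 : exists2 y : R, 0 < y < ell & L2norm Om (up y) != 0%E)
  (* noisy data *)
  (ud : R -> 'rV[R]_d -> R)
  (hud : forall delta : R, 0 < delta ->
     ud delta \in L2 Om /\ (L2norm Om (ud delta \- up0)%R <= delta%:E)%E)
  (* A = mu (- Delta)^(- (sigma + 1)), of norm at most 1 *)
  (mu : R) (hmu : 0 < mu) (B A : ('rV[R]_d -> R) -> 'rV[R]_d -> R)
  (hB : forall v : 'rV[R]_d -> R, v \in L2 Om -> laplace_pow Om lam phi (- (sigma + 1)) v (B v))
  (hA : A = fun v x => mu * B v x)
  (hA1 : forall v : 'rV[R]_d -> R, v \in L2 Om -> (L2norm Om (A v) <= L2norm Om v)%E)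
  (* number of Landweber steps *)
  (l : R) (hl : 0 < l < ell) (N : R) (hN : N = fine (L2norm Om (up l)))
  (istar : R -> nat)
  (histar : exists c1 c2 : R, [/\ 0 < c1, 0 < c2 &
     \forall delta \near 0^'+,
       c1 * (l ^- 2 * ln (N / delta)) <= (istar delta)%:R
         <= c2 * (l ^- 2 * ln (N / delta))])
  (* noise level of the smoothed data *)
  (C2 : R) (hC2 : 0 < C2) (td : R -> R)
  (htd : td = fun delta => C2 * l^-1 * delta * Num.sqrt (ln (N / delta)))
  (* choice of the order of differentiation *)
  (alpha : R -> R)
  (halpha01 : \forall delta \near 0^'+, 0 < alpha (td delta) < 1)
  (halpha1 : alpha (td delta) @[delta --> 0^'+] --> (1 : R))
  (halphaG : Gamma (1 - alpha (td delta)) * td delta @[delta --> 0^'+] --> (0 : R))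
  (* reconstructions *)
  (urec : R -> R -> 'rV[R]_d -> R)
  (hurec : \forall delta \near 0^'+, forall y : R, 0 < y < ell ->
     L2sum Om phi (fun j =>
       coef Om phi (landweber A (ud delta) (istar delta)) j
         / mittag_leffler (alpha (td delta)) 1
             (- Num.sqrt (lam j) * y `^ alpha (td delta))
       + coef Om phi um0 j * expR (- Num.sqrt (lam j) * y)) (urec delta y)) :
  L2Hs_norm Om lam phi ell sigma (fun y => u y \- urec delta y)
    @[delta --> 0^'+] --> 0%E.
Proof.
have pL2 := eigenfunction_L2 hphi.
have pO := eigensystem_orthonormal hphi.
have lam0 := eigensystem_gt0 hphi.
have hL2 : h \in L2 Om by have [] := hh.
have up0L2 : up0 \in L2 Om.
  rewrite hup0 (_ : (fun x => _) = (fun x => 2^-1 * f x + 2^-1 * h x)); last first.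
    by apply/funext => x; ring.
  by apply: L2_lincomb => //; exact: L2_scale.
have usol := coef_solution hphi hf hg hh hu.
rewrite -hup0 -hum0 in usol.
pose m j := Num.sqrt (lam j).
pose c j := coef Om phi up0 j.
have m0 j : 0 < m j by rewrite sqrtr_gt0.
have s1 : 0 < sigma + 1 by rewrite ltr_wpDl.
have p0 : 0 < p^-1 by rewrite invr_gt0 (lt_trans ltr01).
pose l0 := mu `^ (sigma + 1)^-1.
have l00 : 0 < l0 by rewrite powR_gt0.
have hlam : forall j, l0 <= lam j := eigenvalue_ge hphi hmu hB hA hA1 s1.
pose a := landweber_symbol lam (sigma + 1) mu.
have a0 : forall j, 0 < a j := landweber_symbol_gt0 hphi (sigma + 1) hmu.
have a1 : forall j, a j <= 1 := landweber_symbol_le1 hphi hmu hB hA hA1.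
have /andP[ll0 lell] := hl.
(* some coefficient of up0 is nonzero, so N > 0 and the number of Landweber steps
   really tends to infinity *)
have [jN cN] : exists j, c j != 0.
  apply: contrapT => /forallNP c0; have [y hy /eqP] := hupn0; apply.
  have [_ hs] := hup y hy.
  suff E n : L2norm Om (fun x => up y x - \sum_(0 <= j < n)
      coef Om phi up0 j * expR (Num.sqrt (lam j) * y) * phi j x) = L2norm Om (up y).
    move: hs; under eq_fun do rewrite E; move=> hs.
    have hc : (fun=> L2norm Om (up y)) n @[n --> \oo] --> L2norm Om (up y) by exact: cvg_cst.
    by apply: (cvg_unique (@ereal_hausdorff R) hc hs).
  congr L2norm; apply/funext => x; rewrite big1_seq ?subr0// => j _.
  by have /negP := c0 j; rewrite negbK /c => /eqP ->; rewrite !mul0r.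
have N0 : 0 < N.
  have upl := hup l hl; have [uplL2 _] := upl.
  have := coef_norm_le pL2 pO jN uplL2.
  rewrite (coef_L2sum pL2 pO jN upl) hN L2normE//= lee_fin; apply: lt_le_trans.
  by rewrite normr_gt0 mulf_neq0// gt_eqF ?expR_gt0.
have [c1 [c2 [c10 c20 hi]]] := histar.
have hi1 : \forall delta \near 0^'+, c1 * (l ^- 2 * ln (N / delta)) <= (istar delta)%:R.
  by apply: filterS hi => x /andP[].
have hi2 : \forall delta \near 0^'+, (istar delta)%:R <= c2 * (l ^- 2 * ln (N / delta)).
  by apply: filterS hi => x /andP[].
(* the squared a priori norm of the unstable component is the sum of the w j *)
pose W j y := lam j `^ (sigma + (1 + p^-1)) * (c j * expR (m j * y)) ^+ 2.
pose w j := (\int[lebesgue_measure]_(y in `]0%R, ell[) (W j y)%:E)%E.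
have W0 j y : 0 <= W j y by rewrite mulr_ge0 ?powR_ge0 ?sqr_ge0.
have mW j : measurable_fun setT (W j).
  apply: measurable_funM => //; apply: measurable_funX; apply: measurable_funM => //.
  by apply: measurableT_comp => //; exact: measurable_funM.
have w0 j : (0 <= w j)%E by apply: integral_ge0 => y _; rewrite lee_fin.
have w_fin : (\sum_(0 <= j <oo) w j < +oo)%E.
  have <- : (\int[lebesgue_measure]_(y in `]0%R, ell[) \sum_(0 <= j <oo) (W j y)%:E =
      \sum_(0 <= j <oo) w j)%E.
    apply: integral_nneseries => [|j|j y _]; first exact: measurable_itv.
    - by apply: measurable_funTS; apply/measurable_EFinP; exact: mW.
    - by rewrite lee_fin.
  have two : (2^-1 : R) != 0 by rewrite invr_eq0.
  have := lty_poweRy two hupreg; apply: le_lt_trans.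
  rewrite le_eqVlt; apply/orP; left; apply/eqP; apply: eq_integral => y.
  rewrite inE/= in_itv/= => hy; rewrite Hs_norm_sqr; apply: eq_eseriesr => j _.
  by rewrite (coef_L2sum pL2 pO j (hup y hy)) /W -addrA.
pose s := 1 + p^-1.
have s0 : 0 < s by rewrite addr_gt0.
have k0 : 0 < Num.sqrt l0 by rewrite sqrtr_gt0.
have [K K0 hK] := @ml_ratio_dom R _ _ _ k0 hell p0.
pose Kp := K ^+ 2 + (l0 `^ s)^-1.
have Kp0 : 0 <= Kp by rewrite addr_ge0 ?sqr_ge0 ?invr_ge0 ?powR_ge0.
pose G delta := Gamma (1 - alpha (td delta)).
have A0 : 0 <= 4 * mu * ell / l0 by rewrite divr_ge0 ?mulr_ge0 ?(ltW hmu) ?(ltW hell) ?(ltW l00).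
have B0 : 0 <= 4 * mu * ell * (ell + 1) ^+ 2.
  by rewrite mulr_ge0 ?sqr_ge0// mulr_ge0 ?(ltW hell)// mulr_ge0 ?(ltW hmu).
have noise := landweber_noise_cvg0 N0 ll0 c20 hC2 A0 B0 hi2 htd halphaG.
apply: ereal_cvg0 => [delta|e e0]; first exact: poweR_ge0.
have e2 : 0 < e ^+ 2 by rewrite exprn_gt0.
have wS : (\sum_(0 <= j <oo) w j)%E \is a fin_num.
  by rewrite ge0_fin_numE// nneseries_ge0.
pose S := fine (\sum_(0 <= j <oo) w j)%E.
have S0 : 0 <= S by rewrite fine_ge0// nneseries_ge0.
pose e' := e ^+ 2 / (6 * (S + 1)).
have e'0 : 0 < e' by rewrite divr_gt0// mulr_gt0// ltr_wpDl.
(* the target e^2 is split into three parts, for the tail beyond n, for the first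
   n coefficients and for the noise *)
have [n [tn tnE htn]] : exists n, exists2 t : R, (\sum_(n <= j <oo) w j)%E = t%:E &
    2 * Kp * t <= e ^+ 2 / 3.
  have tl := @nneseries_tail_cvg R w xpredT w_fin (fun j _ => w0 j).
  have /fine_cvgP[tf /cvgrPdist_le tc] := tl.
  have x0 : 0 < e ^+ 2 / 3 / (2 * Kp + 1) by rewrite !divr_gt0// ltr_wpDl// mulr_ge0.
  have [n [h1 h2]] := filter_ex (filterI tf (tc _ x0)).
  exists n, (fine (\sum_(n <= j <oo) w j)%E); first by rewrite fineK.
  have t0 : 0 <= fine (\sum_(n <= j <oo) w j)%E by rewrite fine_ge0// nneseries_ge0.
  move: h2; rewrite /= sub0r normrN ger0_norm// ler_pdivlMr ?ltr_wpDl ?mulr_ge0// => h2.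
  by apply: le_trans h2; rewrite mulrC ler_wpM2l// lerDl.
pose q delta j := 1 - (1 - a j) ^+ istar delta.
pose rho delta j y := expR (- (m j * y)) /
  mittag_leffler (alpha (td delta)) 1 (- (m j * y `^ alpha (td delta))).
have a01 j : 0 <= a j <= 1 by rewrite ltW ?a0 ?a1.
have hq delta j : 0 <= q delta j <= 1 by have [] := landweber_filter_bounds (istar delta) (a01 j).
have hlow : \forall delta \near 0^'+, forall j, (j < n)%N -> forall y, 0 < y < ell ->
    (1 - q delta j * rho delta j y) ^+ 2 <= e' * lam j `^ s.
  apply: near_forall_ltn => j.
  (* 9 is the constant of one_sub_sqr_le *)
  pose eta := Num.min 1 (e' * lam j `^ s / 9).
  have el0 : 0 < e' * lam j `^ s by rewrite mulr_gt0 ?powR_gt0.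
  have eta0 : 0 < eta by rewrite lt_min ltr01 divr_gt0.
  have eta1 : eta <= 1 by rewrite ge_min lexx.
  have eta2 : 9 * eta <= e' * lam j `^ s by rewrite mulrC -ler_pdivlMr// ge_min lexx orbT.
  have aj : 0 < a j <= 1 by rewrite a0 a1.
  have f1 := landweber_residual_cvg0 N0 ll0 aj c10 hi1 eta0.
  have f2 : \forall delta \near 0^'+, forall y, 0 < y < ell -> `|rho delta j y - 1| <= eta.
    exact: ml_ratio_cvg ell (ltW (m0 j)) halpha1 halpha01 _ eta0.
  apply: filterS2 f1 f2 => delta h1 h2 y hy.
  apply: (le_trans _ eta2); apply: one_sub_sqr_le => //; first exact: h2.
  by rewrite /q opprB addrC subrK.
have hal : \forall delta \near 0^'+, 1 - p^-1 <= alpha (td delta).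
  by apply: cvgr_ge halpha1 _ _; rewrite gtrBl.
have hnoise : \forall delta \near 0^'+, (istar delta)%:R * delta ^+ 2 *
    (4 * mu * ell / l0 + 4 * mu * ell * (ell + 1) ^+ 2 * G delta ^+ 2) <= e ^+ 2 / 3.
  by apply: cvgr_le noise _ _; rewrite divr_gt0.
near=> delta.
have d0 : 0 < delta by near: delta; exact: nbhs_right_gt.
have al01 : 0 < alpha (td delta) < 1 by near: delta.
have alp : 1 - p^-1 <= alpha (td delta) by near: delta.
have nz : (istar delta)%:R * delta ^+ 2 *
    (4 * mu * ell / l0 + 4 * mu * ell * (ell + 1) ^+ 2 * G delta ^+ 2) <= e ^+ 2 / 3.
  by near: delta.
have low : forall j, (j < n)%N -> forall y, 0 < y < ell ->
    (1 - q delta j * rho delta j y) ^+ 2 <= e' * lam j `^ s by near: delta.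
have rec : forall y : R, 0 < y < ell ->
     L2sum Om phi (fun j =>
       coef Om phi (landweber A (ud delta) (istar delta)) j
         / mittag_leffler (alpha (td delta)) 1
             (- Num.sqrt (lam j) * y `^ alpha (td delta))
       + coef Om phi um0 j * expR (- Num.sqrt (lam j) * y)) (urec delta y).
  by near: delta.
have [udL2 udN] := hud _ d0.
have [_ lwc] := landweber_coef hphi hB hA (istar delta) udL2.
have ddL2 : ud delta \- up0 \in L2 Om by exact: L2_sub.
pose dd j := coef Om phi (ud delta \- up0) j.
have ddE j : coef Om phi (ud delta) j = c j + dd j.
  by rewrite /dd (coef_sub hphi)// /c addrC subrK.
pose Nn := (istar delta)%:R * (2 * mu * (l0^-1 + (ell + 1) ^+ 2 * G delta ^+ 2)).
have Nn0 : 0 <= Nn.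
  rewrite mulr_ge0// mulr_ge0 ?mulr_ge0 ?(ltW hmu)// addr_ge0 ?invr_ge0 ?(ltW l00)//.
  by rewrite mulr_ge0 ?sqr_ge0.
pose beta j := if (j < n)%N then e' else Kp.
have beta0 j : 0 <= beta j by rewrite /beta; case: ifP => // _; exact: ltW.
have G0 : 0 < G delta by rewrite Gamma_gt0// subr_gt0; case/andP: al01.
apply: sqrte_le (ltW e0) _ _; first by apply: integral_ge0 => y _; exact: poweR_ge0.
apply: le_trans (integral_le_series_add (b := fun j => 2 * beta j) (W := W)
  (c := 2 * Nn * delta ^+ 2) hell _ _ W0 mW _) _.
- by rewrite mulr_ge0 ?sqr_ge0// mulr_ge0.
- by move=> j; rewrite mulr_ge0.
- move=> y hy; rewrite poweR_ge0/= Hs_norm_sqr.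
  have [uL2 uE] := usol y hy; have hrec := rec y hy; have [recL2 _] := hrec.
  pose E j := mittag_leffler (alpha (td delta)) 1 (- (m j * y `^ alpha (td delta))).
  have E0 j : 0 < E j by apply: ml_gt0 => //; rewrite mulr_ge0 ?powR_ge0 ?ltW.
  apply: (@series_error_le _ _ c (fun j => expR (m j * y))
    (fun j => (1 - q delta j * rho delta j y) ^+ 2) (fun j => q delta j / E j) dd) => //.
  + move=> j; rewrite (coef_sub hphi)// uE (coef_L2sum pL2 pO j hrec) lwc ddE.
    rewrite mulNr -/(m j) -/(a j) -/(q delta j) -/(E j) mulNr /rho expRN.
    by apply: error_sqr_le; [exact: expR_gt0|exact: E0].
  + move=> j; rewrite /beta; case: ifPn => [jn|_]; first exact: low.
    apply: gain_sqr_le (l00) (hlam j) (ltW s0) (hq _ _) _ _.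
      by rewrite divr_ge0 ?expR_ge0 ?ltW ?E0.
    apply: hK => //; first by lra.
    by rewrite ler_sqrt// ltW.
  + move=> j; apply: noise_weight_le l00 (hlam j) hmu (hq _ _) _ (E0 j) (ltW G0) _ _.
    * by have [] := landweber_filter_bounds (istar delta) (a01 j).
    * by rewrite addr_ge0 ?ltW.
    * by apply: ml_inv_le => //; exact: ltW.
  + apply: le_trans (bessel_series hphi ddL2) _.
    by rewrite lee_fin; apply: L2norm_le_sqr => //; exact: ltW.
have -> : (\sum_(0 <= j <oo) ((2 * beta j)%:E * \int[lebesgue_measure]_(y in `]0%R, ell[) (W j y)%:E)
    = \sum_(0 <= j <oo) ((if (j < n)%N then 2 * e' else 2 * Kp)%:E * w j))%E.
  by apply: eq_eseriesr => j _; rewrite /beta /w; case: ifP.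
have e2' : 0 <= 2 * e' by rewrite mulr_ge0// ltW.
have Kp2 : 0 <= 2 * Kp by rewrite mulr_ge0.
apply: le_trans (leeD (series_two_level n e2' Kp2 w0) (lexx _)) _.
rewrite tnE -(fineK wS) -/S -!EFinM -!EFinD lee_fin.
have h1 : 2 * e' * S <= e ^+ 2 / 3.
  rewrite (_ : 2 * e' * S = e ^+ 2 / 3 * (S / (S + 1))); last first.
    by rewrite /e'; field; rewrite gt_eqF// ltr_wpDl.
  rewrite ler_piMr ?divr_ge0 ?(ltW e2)// ler_pdivrMr ?ltr_wpDl// mul1r lerDl//.
have h3 : 2 * Nn * delta ^+ 2 * ell <= e ^+ 2 / 3.
  apply: le_trans nz; rewrite le_eqVlt; apply/orP; left; apply/eqP.
  by rewrite /Nn; field; rewrite gt_eqF.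
lra.
Unshelve. all: by end_near. Qed.
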